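(* Let $\psi:M^m\to\bar M^{n+1}$ be a mean curvature flow soliton, with constant $c$, with respect to a closed conformal vector field $X\in\Gamma(T\bar M)$ on $\bar M$. Let $\mathbf H$ be its mean curvature vector field. Then $$\tfrac12\Delta_{-cT}|\mathbf H|^2=-c\varphi|\mathbf H|^2-|II_{\mathbf H}|^2+\big|(\bar\nabla_{(\cdot)}\mathbf H)^\perp\big|^2-mc\,\langle\bar\nabla\bar\varphi,\mathbf H\rangle-\operatorname{tr}_M\bar R(\cdot,\mathbf H)\mathbf H,$$ where $T$ is the tangential component of $X$ along the immersion $\psi$, $\bar\varphi=\frac1{n+1}\operatorname{div}_{\bar M}X$, and $\varphi=\bar\varphi\circ\psi$.
   Context: $\bar M^{n+1}$ is a Riemannian manifold with Levi-Civita connection $\bar\nabla$. $X$ is closed conformal if $\bar\nabla_UX=\bar\varphi U$ for all $U\in\Gamma(T\bar M)$. An isometric immersion $\psi:M^m\to\bar M^{n+1}$ is a mean curvature flow soliton with respect to $X$ if $c\,X^\perp=\mathbf H$ along $\psi$ for some constant $c\in\mathbb R$, where $\perp$ is projection on the normal bundle, $II$ is the second fundamental form and $\mathbf H$ is the non-normalized mean curvature vector (the trace of $II$). $II_{\mathbf H}(U,V)=\langle II(U,V),\mathbf H\rangle$, and $|\cdot|$ denotes the usual tensor norms. $\Delta_{-cT}u=\Delta u+c\langle T,\nabla u\rangle$. The curvature tensor is $\bar R(U,V)W=\bar\nabla_U\bar\nabla_VW-\bar\nabla_V\bar\nabla_UW-\bar\nabla_{[U,V]}W$, and $\operatorname{tr}_M\bar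 R(\cdot,\mathbf H)\mathbf H=\sum_{i=1}^m\langle\bar R(e_i,\mathbf H)\mathbf H,e_i\rangle$ for an orthonormal tangent frame $\{e_i\}$ of $M$. *)

(* Defs.v *)
From HB Require Import structures.
From mathcomp Require Import all_boot all_order all_algebra.
From mathcomp Require Import all_classical all_reals all_analysis.
Set Implicit Arguments.
Unset Strict Implicit.
Unset Printing Implicit Defensive.
Import Order.TTheory GRing.Theory Num.Theory.
Import numFieldNormedType.Exports.
Local Open Scope classical_set_scope.
Local Open Scope ring_scope.

Section Smooth.
Variables (R : realType) (V W : normedModType R).

Definition iter_derive (s : seq V) (f : V -> W) : V -> W :=
  foldr (fun v (h : V -> W) => fun x => 'D_v h x) f s.

(* f is C^oo on some neighbourhood of x.  The neighbourhood is the same for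
   all orders of differentiation, so that "smooth_at f x for all x in an open
   set U" is smoothness on U. *)
Definition smooth_at (f : V -> W) (x : V) : Prop :=
  \forall y \near x, forall s : seq V, differentiable (iter_derive s f) y.

End Smooth.

(* A smooth manifold of dimension n without boundary.  The atlas is indexed by
   the points of the manifold: chart p is a chart whose domain contains p. *)
Record manifold (R : realType) (n : nat) := Manifold {
  mspace :> topologicalType;
  mspace_hausdorff : hausdorff_space mspace;
  mspace_second_countable : @second_countable mspace;
  chart_dom : mspace -> set mspace;
  chart : mspace -> mspace -> 'rV[R]_n;
  chart_inv : mspace -> 'rV[R]_n -> mspace;
  chart_dom_mem : forall p, chart_dom p p;
  chart_dom_open : forall p, open (chart_dom p);
  chart_im_open : forall p, open (chart p @` chart_dom p);
  chartK : forall p q, chart_dom p q -> chart_inv p (chart p q) = q;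
  chart_cont : forall p q, chart_dom p q -> {for q, continuous (chart p)};
  chart_inv_cont : forall p x, (chart p @` chart_dom p) x ->
    {for x, continuous (chart_inv p)};
  chart_smooth : forall p q r, chart_dom p r -> chart_dom q r ->
    smooth_at (chart q \o chart_inv p) (chart p r)
}.

Arguments chart_dom {R n m} p _ : rename.
Arguments chart {R n m} p q : rename.
Arguments chart_inv {R n m} p x : rename.

Section Calculus.
Variables (R : realType) (n : nat) (M : manifold R n).

(* The tangent space at p is 'rV_n: a tangent vector at p is the row of its
   components in the distinguished chart at p.  A vector field is a function
   Y : M -> 'rV_n, with Y q the components of Y at q in the chart at q, so
   components at different points must not be compared without coord. *)

Definition msmooth_at (W : normedModType R) (f : M -> W) (p : M) : Prop :=
  smooth_at (f \o chart_inv p) (chart p p).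

Definition mdiff (W : normedModType R) (f : M -> W) (p : M) (v : 'rV[R]_n)
    : W :=
  'd (f \o chart_inv p) (chart p p) v.

(* components in the chart at p of the vector v tangent at q *)
Definition coord (p q : M) (v : 'rV[R]_n) : 'rV[R]_n :=
  'd (chart p \o chart_inv q) (chart q q) v.

(* the vector field near p with constant components v in the chart at p *)
Definition ext (p : M) (v : 'rV[R]_n) : M -> 'rV[R]_n :=
  fun q => 'd (chart q \o chart_inv p) (chart p q) v.

Definition vsmooth_at (Y : M -> 'rV[R]_n) (p : M) : Prop :=
  msmooth_at (fun q => coord p q (Y q)) p.

(* in coordinates, [U, Y]^k = U^i d_i Y^k - Y^i d_i U^k *)
Definition bracket (U Y : M -> 'rV[R]_n) (p : M) : 'rV[R]_n :=
  mdiff (fun q => coord p q (Y q)) p (U p)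
  - mdiff (fun q => coord p q (U q)) p (Y p).

End Calculus.

(* gram p is the Gram matrix of the metric at p in the chart at p. *)
Record riemannian (R : realType) (n : nat) (M : manifold R n) := Riemannian {
  gram :> M -> 'M[R]_n;
  gram_sym : forall p, (gram p)^T = gram p;
  gram_pos : forall p (v : 'rV[R]_n), v != 0 ->
    0 < (v *m gram p *m v^T) 0 0;
  gram_smooth : forall p (U Y : M -> 'rV[R]_n),
    vsmooth_at U p -> vsmooth_at Y p ->
    msmooth_at (fun q => (U q *m gram q *m (Y q)^T) 0 0 : R) p
}.

Section Riemannian.
Variables (R : realType) (n : nat) (M : manifold R n) (g : riemannian M).

Definition metric (p : M) (u v : 'rV[R]_n) : R := (u *m g p *m v^T) 0 0.

(* an orthonormal basis of the tangent space at p (there are n vectors) *)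
Definition orthonormal_frame (p : M) (e : 'I_n -> 'rV[R]_n) : Prop :=
  forall i j, metric p (e i) (e j) = (i == j)%:R.

(* the vector dual to the linear form a: metric p (sharp p a) v = a v *)
Definition sharp (p : M) (a : 'rV[R]_n -> R) : 'rV[R]_n :=
  (\row_i a (delta_mx 0 i)) *m invmx (g p).

Definition grad (f : M -> R) (p : M) : 'rV[R]_n := sharp p (mdiff f p).

(* g^{ij} B(d_i, d_j); see mtrace_frame *)
Definition mtrace (V : lmodType R) (p : M) (B : 'rV[R]_n -> 'rV[R]_n -> V)
    : V :=
  \sum_i \sum_j invmx (g p) i j *: B (delta_mx 0 i) (delta_mx 0 j).

End Riemannian.

Section Connection.
Variables (R : realType) (n : nat) (M : manifold R n).

(* nabla p v Y is the covariant derivative at p, in the direction v, of a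
   vector field Y that is smooth near p. *)
Definition connection := M -> 'rV[R]_n -> (M -> 'rV[R]_n) -> 'rV[R]_n.

Record is_affine_connection (nabla : connection) : Prop := {
  conn_linear : forall p Y, vsmooth_at Y p -> forall (a : R) u v,
    nabla p (a *: u + v) Y = a *: nabla p u Y + nabla p v Y;
  conn_add : forall p v Y Z, vsmooth_at Y p -> vsmooth_at Z p ->
    nabla p v (fun q => Y q + Z q) = nabla p v Y + nabla p v Z;
  conn_leibniz : forall p v (f : M -> R) Y,
    msmooth_at f p -> vsmooth_at Y p ->
    nabla p v (fun q => f q *: Y q) = mdiff f p v *: Y p + f p *: nabla p v Y;
  conn_smooth : forall p U Y, vsmooth_at U p -> vsmooth_at Y p ->
    vsmooth_at (fun q => nabla q (U q) Y) p
}.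

Record is_levi_civita (g : riemannian M) (nabla : connection) : Prop := {
  lc_affine : is_affine_connection nabla;
  lc_metric : forall p v Y Z, vsmooth_at Y p -> vsmooth_at Z p ->
    mdiff (fun q => metric g q (Y q) (Z q)) p v
    = metric g p (nabla p v Y) (Z p) + metric g p (Y p) (nabla p v Z);
  lc_torsion_free : forall p U Y, vsmooth_at U p -> vsmooth_at Y p ->
    nabla p (U p) Y - nabla p (Y p) U = bracket U Y p
}.

Variable nabla : connection.

Definition divergence (Y : M -> 'rV[R]_n) (p : M) : R :=
  \tr (\matrix_(i, j) nabla p (delta_mx 0 i) Y 0 j).

Definition laplacian (g : riemannian M) (f : M -> R) : M -> R :=
  divergence (grad g f).

Definition curvature (U V W : M -> 'rV[R]_n) (p : M) : 'rV[R]_n :=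
  nabla p (U p) (fun q => nabla q (V q) W)
  - nabla p (V p) (fun q => nabla q (U q) W)
  - nabla p (bracket U V p) W.

(* The value on vectors is computed with local extensions. *)
Definition curv_at (p : M) (u v w : 'rV[R]_n) : 'rV[R]_n :=
  curvature (ext p u) (ext p v) (ext p w) p.

Definition closed_conformal (X : M -> 'rV[R]_n) : Prop :=
  (forall p, vsmooth_at X p) /\
  exists f : M -> R, forall p v, nabla p v X = f p *: v.

Definition conformal_factor (X : M -> 'rV[R]_n) (p : M) : R :=
  n%:R^-1 * divergence X p.

End Connection.

Section Immersion.
Variables (R : realType) (m k : nat) (M : manifold R m) (N : manifold R k).
Variables (g : riemannian M) (gN : riemannian N) (nablaN : connection N).
Variable psi : M -> N.

Definition dmap (p : M) (u : 'rV[R]_m) : 'rV[R]_k :=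
  'd (chart (psi p) \o psi \o chart_inv p) (chart p p) u.

Record isometric_immersion : Prop := {
  imm_cont : continuous psi;
  imm_smooth : forall p,
    smooth_at (chart (psi p) \o psi \o chart_inv p) (chart p p);
  imm_inj : forall p, injective (dmap p);
  imm_isom : forall p u v,
    metric gN (psi p) (dmap p u) (dmap p v) = metric g p u v
}.

(* the vector tangent to M at p whose image under the differential of psi is
   the orthogonal projection of w on the tangent space of the immersion *)
Definition tan_part (p : M) (w : 'rV[R]_k) : 'rV[R]_m :=
  sharp g p (fun v => metric gN (psi p) w (dmap p v)).

Definition normal_part (p : M) (w : 'rV[R]_k) : 'rV[R]_k :=
  w - dmap p (tan_part p w).

(* The connection induced by nablaN on vector fields along psi.  In the
   coordinate frame E_b of the chart at psi p it reads
   D_u (V^b E_b) = (u V^b) E_b + V^b nablaN_{dpsi u} E_b,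
   and ext (psi p) (V p) is V^b(p) E_b. *)
Definition along_nabla (p : M) (u : 'rV[R]_m) (V : M -> 'rV[R]_k)
    : 'rV[R]_k :=
  mdiff (fun q => coord (psi p) (psi q) (V q)) p u
  + nablaN (psi p) (dmap p u) (ext (psi p) (V p)).

Definition normal_nabla (p : M) (u : 'rV[R]_m) (V : M -> 'rV[R]_k)
    : 'rV[R]_k :=
  normal_part p (along_nabla p u V).

Definition second_form (p : M) (u v : 'rV[R]_m) : 'rV[R]_k :=
  normal_nabla p u (fun q => dmap q (ext p v q)).

Definition mean_curvature (p : M) : 'rV[R]_k := mtrace g p (second_form p).

Definition second_form_H (p : M) (u v : 'rV[R]_m) : R :=
  metric gN (psi p) (second_form p u v) (mean_curvature p).

Definition mcf_soliton (X : N -> 'rV[R]_k) (c : R) : Prop :=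
  isometric_immersion /\
  forall p, c *: normal_part p (X (psi p)) = mean_curvature p.

End Immersion.

(* Delta_Z f = Delta f - <Z, grad f> *)
Definition drift_laplacian (R : realType) (m : nat) (M : manifold R m)
    (g : riemannian M) (nabla : connection M) (Z : M -> 'rV[R]_m)
    (f : M -> R) (p : M) : R :=
  laplacian nabla g f p - metric g p (Z p) (grad g f p).

Section Sanity.
Variables (R : realType) (n : nat) (M : manifold R n) (g : riemannian M).

Lemma gram_unit (p : M) : g p \in unitmx.
Proof.
rewrite -row_free_unit -kermx_eq0; apply/eqP/row_matrixP => i.
rewrite row0; apply/eqP/negPn/negP => /(gram_pos g p).
by rewrite -row_mul mulmx_ker row0 mul0mx mxE ltxx.
Qed.

Lemma metric_sharp (p : M) (a : 'rV[R]_n -> R) (v : 'rV[R]_n) :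
  (forall b u w, a (b *: u + w) = b * a u + a w) ->
  metric g p (sharp g p a) v = a v.
Proof.
move=> alin; have a0 : a 0 = 0.
  by have := alin (-1) 0 0; rewrite scaler0 addr0 mulN1r addNr.
have aZ b u : a (b *: u) = b * a u by rewrite -[b *: u]addr0 alin a0 addr0.
have aD u w : a (u + w) = a u + a w by rewrite -[u]scale1r alin mul1r scale1r.
rewrite /metric /sharp -(mulmxA (\row__ _)) mulVmx ?gram_unit // mulmx1 mxE.
rewrite [in RHS](row_sum_delta v) (big_morph a aD a0).
by apply: eq_bigr => i _; rewrite !mxE aZ mulrC.
Qed.

Lemma mtrace_frame (V : lmodType R) (p : M) (e : 'I_n -> 'rV[R]_n)
    (B : 'rV[R]_n -> 'rV[R]_n -> V) :
  (forall a u v w, B (a *: u + v) w = a *: B u w + B v w) ->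
  (forall a u v w, B w (a *: u + v) = a *: B w u + B w v) ->
  orthonormal_frame g p e ->
  mtrace g p B = \sum_i B (e i) (e i).
Proof.
move=> Bl Br oe; pose E : 'M[R]_n := \matrix_i e i.
have EGE : E *m g p *m E^T = 1%:M.
  apply/matrixP => i j; rewrite !mxE -oe /metric !mxE.
  apply: eq_bigr => k _; rewrite !mxE; congr (_ * _).
  by apply: eq_bigr => l _; rewrite !mxE.
have GV : invmx (g p) = E^T *m E.
  have h : E^T *m E *m g p = 1%:M.
    by rewrite -mulmxA; apply: mulmx1C.
  by rewrite -[LHS]mul1mx -h mulmxK // gram_unit.
have B0l w : B 0 w = 0.
  by have := Bl (-1) 0 0 w; rewrite scaler0 addr0 scaleN1r addNr.
have B0r w : B w 0 = 0.
  by have := Br (-1) 0 0 w; rewrite scaler0 addr0 scaleN1r addNr.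
have sl w (I : Type) (r : seq I) (a : I -> R) (x : I -> 'rV[R]_n) :
    B (\sum_(i <- r) a i *: x i) w = \sum_(i <- r) a i *: B (x i) w.
  by elim: r => [|i r IH]; rewrite ?big_nil // !big_cons Bl IH.
have sr w (I : Type) (r : seq I) (a : I -> R) (x : I -> 'rV[R]_n) :
    B w (\sum_(i <- r) a i *: x i) = \sum_(i <- r) a i *: B w (x i).
  by elim: r => [|i r IH]; rewrite ?big_nil // !big_cons Br IH.
rewrite /mtrace GV.
have Bee i : B (e i) (e i) =
    \sum_k \sum_l (E i k * E i l) *: B (delta_mx 0 k) (delta_mx 0 l).
  rewrite {1}(row_sum_delta (e i)) sl; apply: eq_bigr => k _.
  rewrite (row_sum_delta (e i)) sr scaler_sumr; apply: eq_bigr => l _.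
  by rewrite scalerA -row_sum_delta !mxE.
under [RHS]eq_bigr do rewrite Bee.
rewrite [RHS]exchange_big /=; apply: eq_bigr => k _.
rewrite [RHS]exchange_big /=; apply: eq_bigr => l _.
rewrite -scaler_suml; congr (_ *: _); rewrite mxE.
by apply: eq_bigr => i _; rewrite mxE.
Qed.

End Sanity.

(* Main.v *)
(* The soliton equation reads H = c X - c dpsi(T), so the covariant derivative
   of H along psi is D_u H = c phi dpsi(u) - c D_u dpsi(T); paired with H this
   gives d|H|^2(u) = -2c <II(u, T), H>.  The Laplacian at p is computed in a
   frame F_i, with reciprocal frame F'_i, both orthonormal and parallel at p.
   Differentiating <D_(F_j) dpsi(F_i), H> along e_i and exchanging the two
   derivatives (this is the Codazzi equation) produces the curvature term and
   the derivative of the trace |H|^2 = sum_i <D_(F'_i) dpsi(F_i), H>, which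
   cancels the drift.  Closed conformality enters through
   R(u, v) X = u(phi) v - v(phi) u and through
   c <nabla_u T, v> = c phi <u, v> + <II(u, v), H>. *)
From mathcomp Require Import all_boot all_order all_algebra.
From mathcomp Require Import all_classical all_reals all_analysis.
From mathcomp Require Import ring lra.
Require Import Defs.
Set Implicit Arguments.
Unset Strict Implicit.
Unset Printing Implicit Defensive.
Import Order.TTheory GRing.Theory Num.Theory.
Import numFieldNormedType.Exports.
Local Open Scope classical_set_scope.
Local Open Scope ring_scope.

(** * Smooth functions on normed spaces *)

(** An identity can be differentiated at [p] only if it holds on a neighbourhood of [p]. A frame
    parallel at [p] is in general orthonormal at [p] alone, hence the second frame: [<F_i, F'_j>]
    stays constant near [p], so the trace giving |H|^2 and the expansion of [T] hold where they are
    differentiated. Likewise [<D_(F_j) dpsi(F_i), H>] replaces the second fundamental form near [p]: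
    pairing with [H] removes tangential parts at every point. The constant [c] may vanish, so the
    soliton equation is used only in the form c dpsi(T) = c X - H.

    The other obstacle is that each point carries its own chart and that a connection is an operator
    on fields known only through its axioms. Fields along psi are therefore expanded in one
    coordinate frame of N. Commuting second derivatives of functions and the symmetry of the
    Christoffel symbols then give the torsion and curvature formulas along psi, and pulled-back
    fields give compatibility with the metric. *)

Section Germs.
Variables (R : realType) (V W : normedModType R).
Implicit Types f g : V -> W.

Lemma near_eq_diff_shift f g x : {near x, f =1 g} -> differentiable f x ->
  g \o shift x = cst (g x) + 'd f x +o_ 0 id.
Proof.
move=> fg df; have /diff_locally := df => E.
have gx : g x = f x by rewrite (nbhs_singleton fg).
apply/eqaddoP => e e0; move/eqaddoP: E => /(_ e e0) E.
have fg0 : \forall h \near (0 : V), f (h + x) = g (h + x).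
  by move: fg; rewrite (near_shift 0 x) /=; apply: filterS => y; rewrite subr0.
near=> h; rewrite gx.
have -> : (g \o shift x - (cst (f x) + 'd f x)) h =
  (f \o shift x - (cst (f x) + 'd f x)) h.
  rewrite /= !fctE /=; congr (_ - _); symmetry; near: h; exact: fg0.
near: h; exact: E.
Unshelve. all: by end_near. Qed.

Lemma near_eq_diff f g x : {near x, f =1 g} -> differentiable f x ->
  'd g x = 'd f x :> (V -> W).
Proof.
by move=> fg df; apply/diff_unique; [exact: diff_continuous|exact: near_eq_diff_shift].
Qed.

Lemma near_eq_diff_app f g x v : {near x, f =1 g} -> differentiable f x ->
  'd g x v = 'd f x v.
Proof. by move=> fg df; rewrite (near_eq_diff fg df). Qed.

Lemma near_eq_differentiable f g x : {near x, f =1 g} -> differentiable f x ->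
  differentiable g x.
Proof.
move=> fg df; apply/diff_locallyP; rewrite (near_eq_diff fg df).
by split; [exact: diff_continuous|exact: near_eq_diff_shift].
Qed.

Definition smooth_on (U : set V) f :=
  forall (s : seq V) x, U x -> differentiable (iter_derive s f) x.

Lemma smooth_atP f x :
  smooth_at f x <-> exists2 U, open_nbhs x U & smooth_on U f.
Proof.
split=> [|[U xU sU]].
  rewrite /smooth_at -nbhs_nearE nbhsE => -[U oU sU].
  by exists U => // s y /sU; apply.
rewrite /smooth_at -nbhs_nearE nbhsE.
by exists U => // y Uy s; apply: sU.
Qed.

Lemma smooth_on_at f U x : open U -> U x -> smooth_on U f -> smooth_at f x.
Proof. by move=> oU Ux sU; apply/smooth_atP; exists U. Qed.

Lemma smooth_at_near f x : smooth_at f x -> \forall y \near x, smooth_at f y.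
Proof. by move=> sf; apply: (near_join sf). Qed.

Lemma smooth_at_diff f x : smooth_at f x -> differentiable f x.
Proof. by move=> /nbhs_singleton /(_ [::]). Qed.

Lemma iter_derive_rcons s v f :
  iter_derive (rcons s v) f = iter_derive s (fun x => 'D_v f x).
Proof. by rewrite /iter_derive foldr_rcons. Qed.

Lemma smooth_at_derive f x v : smooth_at f x -> smooth_at (fun y => 'D_v f y) x.
Proof. by apply: filterS => y sf s; rewrite -iter_derive_rcons; apply: sf. Qed.

(* Smoothness is coinductive: a class of differentiable functions stable under
   directional derivatives consists of smooth functions. *)
Lemma smooth_on_coind (U : set V) (P : (V -> W) -> Prop) : open U ->
  (forall f x, P f -> U x -> differentiable f x) ->
  (forall f v, P f -> exists2 g, P g & forall x, U x -> 'D_v f x = g x) ->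
  forall f, P f -> smooth_on U f.
Proof.
move=> oU Pd PD f Pf s.
have [g Pg fg] : exists2 g, P g & forall x, U x -> iter_derive s f x = g x.
  elim: s => [|v s [g Pg fg]]; first by exists f.
  have [h Ph gh] := PD g v Pg; exists h => // x Ux.
  rewrite -gh //=; apply: near_eq_derive.
  by apply: filterS fg _; apply: open_nbhs_nbhs.
move=> x Ux; apply: (@near_eq_differentiable g) (Pd _ _ Pg Ux).
by apply: filterS (open_nbhs_nbhs (conj oU Ux)) => y /fg.
Qed.

Lemma smooth_on_derive (U : set V) f v :
  smooth_on U f -> smooth_on U (fun x => 'D_v f x).
Proof. by move=> sf s x Ux; rewrite -iter_derive_rcons; apply: sf. Qed.

Lemma smooth_at_eq f g x : {near x, f =1 g} -> smooth_at f x -> smooth_at g x.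
Proof.
move=> fg sf; have : nbhs x [set y | f y = g y /\
    forall s, differentiable (iter_derive s f) y] by apply: filterI.
rewrite nbhsE => -[U [oU Ux] sU]; apply: (smooth_on_at oU Ux).
(* The coinductive class consists of the functions that agree on [U] with a smooth one. Equality on
   an open set passes to directional derivatives. *)
apply: (@smooth_on_coind U (fun h => exists2 k, smooth_on U k &
  forall y, U y -> k y = h y)) => //.
- move=> h y [k sk kh] Uy; apply: (@near_eq_differentiable k) (sk [::] y Uy).
  by apply: filterS (open_nbhs_nbhs (conj oU Uy)) => z /kh.
- move=> h v [k sk kh]; exists (fun x => 'D_v k x).
    by exists (fun x => 'D_v k x) => //; apply: smooth_on_derive.
  move=> y Uy; apply: near_eq_derive.
  by apply: filterS (open_nbhs_nbhs (conj oU Uy)) => z /kh.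
by exists f => [s y /sU[_]|y /sU[]].
Qed.

End Germs.

Lemma diff_comp_app (R : realType) (V W Z : normedModType R) (f : V -> W) (g : W -> Z)
    x y v : f x = y -> differentiable f x -> differentiable g y ->
  'd g y ('d f x v) = 'd (fun z => g (f z)) x v.
Proof. by move=> <- df dg; rewrite (@diff_comp _ _ _ _ f g). Qed.

Lemma differentiable_comp_at (R : realType) (V W Z : normedModType R) (f : V -> W)
    (g : W -> Z) x y : f x = y -> differentiable f x -> differentiable g y ->
  differentiable (fun z => g (f z)) x.
Proof. by move=> <- df dg; exact: differentiable_comp. Qed.

Lemma diffD_app (R : realType) (V W : normedModType R) (f g : V -> W) x v :
  differentiable f x -> differentiable g x ->
  'd (fun y => f y + g y) x v = 'd f x v + 'd g x v.
Proof. by move=> df dg; rewrite (diffD df dg). Qed.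

Lemma diffM_app (R : realType) (V : normedModType R) (f g : V -> R) x v :
  differentiable f x -> differentiable g x ->
  'd (fun y => f y * g y) x v = f x * 'd g x v + g x * 'd f x v.
Proof. by move=> df dg; rewrite (diffM df dg). Qed.

(** * Vector-valued functions and their components *)

Section Components.
Variables (R : realType) (V : normedModType R) (k : nat).
Implicit Types f : V -> 'rV[R]_k.

Lemma differentiable_rV f x :
  (forall b, differentiable (fun y => f y 0 b) x) -> differentiable f x.
Proof.
move=> df; have -> : f = \sum_b (fun y => f y 0 b *: (delta_mx 0 b : 'rV[R]_k)).
  by apply/funext => y; rewrite [LHS]row_sum_delta fct_sumE.
by apply: differentiable_sum => b; apply: differentiableZl.
Qed.

Lemma differentiable_comp_rV f x b :
  differentiable f x -> differentiable (fun y => f y 0 b) x.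
Proof.
move=> df; apply: (@differentiable_comp _ _ _ _ f (fun A : 'rV[R]_k => A 0 b)) => //.
exact: differentiable_coord.
Qed.

Lemma derive_comp_rV f x v b : differentiable f x ->
  'D_v (fun y => f y 0 b) x = 'D_v f x 0 b.
Proof. by move=> /diff_derivable df; rewrite derive_mx // mxE. Qed.

Lemma smooth_on_rV (U : set V) f : open U ->
  (forall b, smooth_on U (fun y => f y 0 b)) -> smooth_on U f.
Proof.
move=> oU sf.
apply: (@smooth_on_coind _ _ _ U
  (fun f => forall b, smooth_on U (fun y => f y 0 b)) oU _ _ f sf) => {f sf}.
  by move=> f x sf Ux; apply: differentiable_rV => b; apply: (sf b [::]).
move=> f v sf; exists (fun x => \row_b 'D_v (fun y => f y 0 b) x).
  move=> b; have := smooth_on_derive v (sf b).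
  by congr (smooth_on _ _); apply/funext => x; rewrite mxE.
move=> x Ux; rewrite derive_mx.
  by apply/rowP => b; rewrite !mxE.
by apply: diff_derivable; apply: differentiable_rV => b; apply: (sf b [::]).
Qed.

Lemma smooth_on_comp_rV (U : set V) f b : open U ->
  smooth_on U f -> smooth_on U (fun y => f y 0 b).
Proof.
move=> oU sf.
pose P (h : V -> R) := exists2 f' : V -> 'rV[R]_k, smooth_on U f' & h = (fun y => f' y 0 b).
have Pf : P (fun y => f y 0 b) by exists f.
apply: (@smooth_on_coind _ _ _ U P oU _ _ _ Pf).
  by move=> _ x [h sh ->] Ux; apply: differentiable_comp_rV; apply: (sh [::]).
move=> _ v [h sh ->]; exists (fun y => 'D_v h y 0 b).
  by exists (fun y => 'D_v h y) => //; apply: smooth_on_derive.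
by move=> x Ux; apply: derive_comp_rV; apply: (sh [::]).
Qed.

Lemma smooth_at_rVP f x :
  smooth_at f x <-> forall b, smooth_at (fun y => f y 0 b) x.
Proof.
split=> [/smooth_atP[U [oU Ux] sU] b|sf].
  by apply: (smooth_on_at oU Ux); apply: smooth_on_comp_rV.
have : nbhs x [set y | forall b s, differentiable (iter_derive s (fun y => f y 0 b)) y].
  by apply: filter_forall => b; apply: sf.
rewrite nbhsE => -[U [oU Ux] sU]; apply: (smooth_on_at oU Ux).
by apply: smooth_on_rV => // b s y /sU; apply.
Qed.

End Components.

(** * Closure of smoothness under algebraic operations and composition *)

Section Calculus.
Variables (R : realType) (V : normedModType R).

(** The sum, product, quotient and chain rules write the derivative of a generated function as
    another generated function. Coinduction on this class therefore proves all closure properties at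
    once and avoids formulas for derivatives of higher order. *)
Inductive smooth_gen (U : set V) : (V -> R) -> Prop :=
| smooth_gen_base f of smooth_on U f : smooth_gen U f
| smooth_gen_add f g of smooth_gen U f & smooth_gen U g :
    smooth_gen U (fun x => f x + g x)
| smooth_gen_mul f g of smooth_gen U f & smooth_gen U g :
    smooth_gen U (fun x => f x * g x)
| smooth_gen_inv f of smooth_gen U f & (forall x, U x -> f x != 0) :
    smooth_gen U (fun x => (f x)^-1)
| smooth_gen_comp k (B : set 'rV[R]_k) (f : 'rV[R]_k -> R) (h : V -> 'rV[R]_k)
    of smooth_on B f & (forall b, smooth_gen U (fun x => h x 0 b)) &
    (forall x, U x -> B (h x)) : smooth_gen U (fun x => f (h x)).

Lemma smooth_on_cst (W : normedModType R) (U : set V) (a : W) :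
  open U -> smooth_on U (cst a).
Proof.
move=> oU; apply: (@smooth_on_coind _ _ _ U (fun f => exists a, f = cst a) oU
  _ _ _ (ex_intro _ a erefl)).
- by move=> _ x [b ->] _; apply: differentiable_cst.
- by move=> _ v [b ->]; exists (cst 0); [exists 0|move=> x _; rewrite derive_cst].
Qed.

Lemma smooth_gen_sum (U : set V) n (f : 'I_n -> V -> R) : open U ->
  (forall i, smooth_gen U (f i)) -> smooth_gen U (fun x => \sum_i f i x).
Proof.
move=> oU; elim: n f => [|n IH] f sf.
  rewrite [X in smooth_gen _ X](_ : _ = cst 0).
    by constructor; apply: smooth_on_cst.
  by apply/funext => x; rewrite big_ord0.
rewrite [X in smooth_gen _ X](_ : _ = (fun x => f ord0 x + \sum_i f (lift ord0 i) x)).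
  by apply: smooth_gen_add => //; apply: IH.
by apply/funext => x; rewrite big_ord_recl.
Qed.

Lemma derive_comp_sum k (f : 'rV[R]_k -> R) (h : V -> 'rV[R]_k) x v :
  differentiable h x -> differentiable f (h x) ->
  'D_v (fun y => f (h y)) x =
  \sum_b 'D_v (fun y => h y 0 b) x * 'D_(delta_mx 0 b) f (h x).
Proof.
move=> dh df; rewrite deriveE; last exact: (@differentiable_comp _ _ _ _ h f).
rewrite (@diff_comp _ _ _ _ h f) //= (row_sum_delta ('d h x v)) linear_sum.
by apply: eq_bigr => b _; rewrite linearZ /= -(deriveE _ dh) -(deriveE _ df) derive_comp_rV.
Qed.

Lemma smooth_gen_diff (U : set V) f x : open U ->
  smooth_gen U f -> U x -> differentiable f x.
Proof.
move=> oU; elim=> {f}.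
- by move=> f sf Ux; apply: (sf [::]).
- move=> f g _ df _ dg Ux. have := differentiableD (df Ux) (dg Ux). exact.
- by move=> f g _ df _ dg Ux; apply: differentiableM; [apply: df|apply: dg].
- by move=> f _ df f0 Ux; apply: differentiableV; [apply: df|apply: f0].
move=> k B f h sf _ dh hB Ux; apply: (@differentiable_comp _ _ _ _ h f).
  by apply: differentiable_rV => b; apply: dh.
exact: (sf [::] _ (hB _ Ux)).
Qed.

Lemma smooth_gen_derive (U : set V) f v : open U -> smooth_gen U f ->
  exists2 g, smooth_gen U g & forall x, U x -> 'D_v f x = g x.
Proof.
move=> oU; elim=> {f}.
- move=> f sf; exists (fun x => 'D_v f x) => //.
  by constructor; apply: smooth_on_derive.
- move=> f g sf [f' sf' Df] sg [g' sg' Dg].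
  exists (fun x => f' x + g' x); first exact: smooth_gen_add.
  move=> x Ux; rewrite -Df // -Dg //.
  by rewrite -deriveD //; apply: diff_derivable; exact: smooth_gen_diff Ux.
- move=> f g sf [f' sf' Df] sg [g' sg' Dg].
  exists (fun x => f x * g' x + g x * f' x).
    exact: smooth_gen_add (smooth_gen_mul sf sg') (smooth_gen_mul sg sf').
  move=> x Ux; rewrite -Df // -Dg //.
  by rewrite -[_ * _ + _]deriveM //; apply: diff_derivable; exact: smooth_gen_diff Ux.
- move=> f sf [f' sf' Df] f0.
  (* The derivative of the inverse is spelled as a product so that the constructors of [smooth_gen]
     apply to it. *)
  exists (fun x => -1 * (f x)^-1 * (f x)^-1 * f' x).
    have si := smooth_gen_inv sf f0.
    have sN : smooth_gen U (cst (-1 : R)).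
      by apply: smooth_gen_base; exact: smooth_on_cst.
    exact: (smooth_gen_mul (smooth_gen_mul (smooth_gen_mul sN si) si) sf').
  move=> x Ux; rewrite -Df //.
  rewrite [LHS]deriveV ?f0 //; last by apply: diff_derivable; exact: smooth_gen_diff Ux.
  by rewrite -[_ *: _]/(_ * _) mulN1r mulNr -invfM expr2 mulNr.
move=> k B f h sf sh Dh hB.
have /choice[h' Dh'] : forall b, exists h', smooth_gen U h' /\
    forall x, U x -> 'D_v (fun y => h y 0 b) x = h' x.
  by move=> b; have [h' ? ?] := Dh b; exists h'.
(* By the chain rule only derivatives of the outer function are composed with [h], and these are
   again smooth on [B]. *)
exists (fun x => \sum_b h' b x * 'D_(delta_mx 0 b) f (h x)).
  apply: smooth_gen_sum => // b; apply: smooth_gen_mul; first by have [] := Dh' b.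
  apply: (@smooth_gen_comp _ _ B (fun z => 'D_(delta_mx 0 b) f z)) => //.
  exact: smooth_on_derive.
move=> x Ux; rewrite derive_comp_sum; last exact: (sf [::] _ (hB _ Ux)).
  by apply: eq_bigr => b _; have [_ ->] := Dh' b.
by apply: differentiable_rV => b; exact: smooth_gen_diff Ux.
Qed.

Lemma smooth_gen_on (U : set V) f : open U -> smooth_gen U f -> smooth_on U f.
Proof.
move=> oU sf; apply: (@smooth_on_coind _ _ _ U (smooth_gen U) oU _ _ _ sf).
  by move=> {sf}f x /(smooth_gen_diff oU); apply.
by move=> {sf}f v sf; exact: smooth_gen_derive.
Qed.

Implicit Types f g : V -> R.

Lemma smooth_at_cst (W : normedModType R) (a : W) x : smooth_at (cst a : V -> W) x.
Proof. by apply: (smooth_on_at openT I); apply: smooth_on_cst openT. Qed.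

Lemma smooth_at_gen2 f g x : smooth_at f x -> smooth_at g x ->
  exists U, [/\ open U, U x, smooth_gen U f & smooth_gen U g].
Proof.
move=> sf sg; have : nbhs x [set y | (forall s, differentiable (iter_derive s f) y)
    /\ forall s, differentiable (iter_derive s g) y] by apply: filterI.
rewrite nbhsE => -[U [oU Ux] sU]; exists U; split => //; constructor => s y.
  by case/sU.
by case/sU.
Qed.

Lemma smooth_atD f g x : smooth_at f x -> smooth_at g x ->
  smooth_at (fun y => f y + g y) x.
Proof.
move=> sf sg; have [U [oU Ux Uf Ug]] := smooth_at_gen2 sf sg.
by apply: (smooth_on_at oU Ux (smooth_gen_on oU _)); apply: smooth_gen_add.
Qed.

Lemma smooth_atM f g x : smooth_at f x -> smooth_at g x ->
  smooth_at (fun y => f y * g y) x.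
Proof.
move=> sf sg; have [U [oU Ux Uf Ug]] := smooth_at_gen2 sf sg.
by apply: (smooth_on_at oU Ux (smooth_gen_on oU _)); apply: smooth_gen_mul.
Qed.

Lemma smooth_atV f x : smooth_at f x -> f x != 0 ->
  smooth_at (fun y => (f y)^-1) x.
Proof.
move=> sf fx; have fc := differentiable_continuous (smooth_at_diff sf).
have : nbhs x [set y | (forall s, differentiable (iter_derive s f) y) /\ f y != 0].
  apply: filterI; first exact: sf.
  by apply: (fc [set r | r != 0]); apply: open_nbhs_nbhs; split => //; exact: open_neq.
rewrite nbhsE => -[U [oU Ux] sU]; apply: (smooth_on_at oU Ux (smooth_gen_on oU _)).
by apply: smooth_gen_inv => [|y /sU[]//]; constructor => s y /sU[].
Qed.

Lemma smooth_at_comp k (f : 'rV[R]_k -> R) (h : V -> 'rV[R]_k) x :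
  smooth_at f (h x) -> smooth_at h x -> smooth_at (fun y => f (h y)) x.
Proof.
move=> sf sh; have hc := differentiable_continuous (smooth_at_diff sh).
have [B [oB Bh] sB] := (smooth_atP _ _).1 sf.
have : nbhs x [set y | (forall s, differentiable (iter_derive s h) y) /\ B (h y)].
  by apply: filterI; [exact: sh|apply: (hc B); exact: open_nbhs_nbhs].
rewrite nbhsE => -[U [oU Ux] sU]; apply: (smooth_on_at oU Ux (smooth_gen_on oU _)).
apply: (smooth_gen_comp sB) => [b|y /sU[]//].
by constructor; apply: smooth_on_comp_rV => // s y /sU[].
Qed.

End Calculus.

(** * Symmetry of second derivatives *)

Section Schwarz.
Variables (R : realType) (V : normedModType R).
Implicit Types f : V -> R.

Lemma is_derive_line f (u w : V) (s : R) : differentiable f (s *: u + w) ->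
  is_derive s 1 (fun t : R => f (t *: u + w)) ('D_u f (s *: u + w)).
Proof.
move=> df; pose h (t : R) := t *: u + w.
have dh : is_diff s h (fun t => t *: u).
  have := is_diffD (is_diff_scalel s u) (is_diff_cst w s).
  by congr (is_diff_def _ _ _); apply/funext => t; rewrite /= addr0.
have dfh : differentiable (f \o h) s by apply: differentiable_comp.
apply: DeriveDef; first exact: diff_derivable.
rewrite (@deriveE _ _ _ (f \o h)) // (@diff_comp _ _ _ _ h f) // deriveE //=.
by rewrite (@diff_val _ _ _ _ _ _ _ dh) scale1r.
Qed.

(** The mean value theorem in the direction [u] turns the second difference into a difference of two
    values of ['D_u f]. Differentiability of ['D_u f] at the single point [x] then evaluates it up
    to o(t^2). *)
Lemma second_difference f (x u v : V) (e : R) :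
  (\forall y \near x, differentiable f y) ->
  differentiable (fun y => 'D_u f y) x -> 0 < e ->
  \forall t \near (0 : R), 0 < t ->
    `|f (x + t *: u + t *: v) - f (x + t *: u) - f (x + t *: v) + f x
      - t ^+ 2 * 'D_v (fun y => 'D_u f y) x| <= e * t ^+ 2.
Proof.
move=> nf dDf e0; rewrite (deriveE v dDf).
set g := fun y => 'D_u f y; set L := 'd g x.
(* The two error terms are taken at vectors of norm at most t(|u| + |v|) and t|u|, which add up to
   t(2|u| + |v|). The summand 1 keeps the constant positive when both vectors vanish. *)
have K0 : 0 < 2 * `|u| + `|v| + 1 by rewrite ltr_wpDl // addr_ge0 ?mulr_ge0.
pose e' := e / (2 * `|u| + `|v| + 1); have e'0 : 0 < e' by rewrite divr_gt0.
have : \forall h \near (0 : V), `|g (h + x) - g x - L h| <= e' * `|h| /\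
    differentiable f (h + x).
  apply: filterI; last first.
    by move: nf; rewrite (near_shift 0 x) /=; apply: filterS => y; rewrite subr0.
  have /diff_locally/eqaddoP := dDf => /(_ e' e'0); apply: filterS => h /=.
  by rewrite !fctE /= opprD addrA.
move/nbhs_normP => [d /= d0 Hd].
have Hd' h : `|h| < d -> `|g (h + x) - g x - L h| <= e' * `|h| /\
    differentiable f (h + x).
  by move=> hd; apply: Hd; rewrite /= sub0r normrN.
near=> t => t0.
have td : t * (2 * `|u| + `|v| + 1) < d.
  rewrite -ltr_pdivlMr //; near: t.
  by apply: num_topology.nbhs0_lt; rewrite divr_gt0.
have bnd s r : 0 <= s <= t -> 0 <= r <= t ->
    `|s *: u + r *: v| <= t * (`|u| + `|v|).
  move=> /andP[s0 st] /andP[r0 rt]; apply: le_trans (ler_normD _ _) _.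
  by rewrite !normrZ !ger0_norm // mulrDr lerD // ler_wpM2r.
have bnd' s r : 0 <= s <= t -> 0 <= r <= t -> `|s *: u + r *: v| < d.
  move=> st rt; apply: le_lt_trans (bnd s r st rt) _; apply: le_lt_trans td.
  by rewrite ler_pM2l // -subr_ge0; have := normr_ge0 u; lra.
(* The second difference is [phi t - phi 0], and [dphi] is the derivative of [phi]. *)
pose phi s := f (s *: u + (t *: v + x)) - f (s *: u + x).
pose dphi s := g (s *: u + (t *: v + x)) - g (s *: u + x).
have t00 : (0 : R) <= t <= t by rewrite ltW //=.
have z00 : (0 : R) <= 0 <= t by rewrite lexx ltW.
have dph s : 0 <= s <= t -> is_derive s 1 phi (dphi s).
  move=> st; apply: is_deriveB.
    apply: is_derive_line; rewrite addrA.
    by have [] := Hd' _ (bnd' s t st t00).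
  apply: is_derive_line; have := bnd' s 0 st z00; rewrite scale0r addr0.
  by case/Hd'.
have [] := @MVT R phi dphi 0 t t0.
- by move=> s; rewrite in_itv /= => /andP[s0 st]; apply: dph; rewrite !ltW.
- apply: derivable_within_continuous => s; rewrite in_itv /= => st.
  by have [] := dph s st.
move=> xi; rewrite in_itv /= => /andP[xi0 xit]; rewrite subr0 => phE.
have xi01 : 0 <= xi <= t by rewrite !ltW.
have -> : f (x + t *: u + t *: v) - f (x + t *: u) - f (x + t *: v) + f x =
    phi t - phi 0.
  rewrite /phi scale0r !add0r.
  rewrite (_ : x + t *: u + t *: v = t *: u + (t *: v + x)); last first.
    by rewrite addrC addrCA (addrC x) addrA (addrC (t *: u)) -addrA addrC.
  rewrite (addrC x (t *: u)) (addrC x (t *: v)); ring.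
rewrite phE /dphi.
have [B1 _] := Hd' _ (bnd' xi t xi01 t00).
have := bnd' xi 0 xi01 z00; rewrite scale0r addr0 => /Hd'[B2 _].
have Lv : L (xi *: u + t *: v) = L (xi *: u) + t * L v.
  by rewrite linearD; congr (_ + _); rewrite linearZ.
(* Both values of [g] are compared with the linear approximation at [x]. The unknown [xi] drops out
   of the linear parts, whose difference is [t * L v]. *)
have -> : (g (xi *: u + (t *: v + x)) - g (xi *: u + x)) * t - t ^+ 2 * L v =
   t * ((g (xi *: u + t *: v + x) - g x - L (xi *: u + t *: v))
        - (g (xi *: u + x) - g x - L (xi *: u))).
  by rewrite Lv addrA; ring.
rewrite normrM gtr0_norm // expr2 mulrCA ler_pM2l //.
apply: le_trans (ler_normB _ _) _; apply: le_trans (lerD B1 B2) _.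
have b1 := bnd xi t xi01 t00.
have b2 : `|xi *: u| <= t * `|u|.
  by rewrite normrZ gtr0_norm // ler_wpM2r // ltW.
apply: (@le_trans _ _ (e' * (t * (`|u| + `|v|) + t * `|u|))).
  by rewrite -mulrDr ler_wpM2l ?(ltW e'0) // lerD.
have -> : e * t = e' * (t * (2 * `|u| + `|v| + 1)).
  by rewrite /e' [RHS]mulrCA divfK ?gt_eqF // mulrC.
rewrite ler_pM2l // -mulrDr ler_pM2l //; have := normr_ge0 u; lra.
Unshelve. all: by end_near. Qed.

(** The second difference is symmetric in [u] and [v], so both mixed derivatives approximate the
    same number. Each of the two estimates contributes half of [e]. *)
Lemma derive_sym f (x u v : V) :
  (\forall y \near x, differentiable f y) ->
  differentiable (fun y => 'D_u f y) x -> differentiable (fun y => 'D_v f y) x ->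
  'D_v (fun y => 'D_u f y) x = 'D_u (fun y => 'D_v f y) x.
Proof.
move=> nf du dv; apply/eqP; rewrite -subr_eq0 -normr_le0; apply/ler_addgt0Pl => e e0.
have e20 : 0 < e / 2 by rewrite divr_gt0.
have H1 := second_difference v nf du e20.
have H2 := second_difference u nf dv e20.
have [d /= d0 Hd] := (nbhs_normP _ _).1 (filterI H1 H2).
pose t := d / 2; have t0 : 0 < t by rewrite divr_gt0.
have td : ball_ Num.Def.normr (0 : R) d t.
  by rewrite /ball_ /= sub0r normrN gtr0_norm // /t ltr_pdivrMr // ltr_pMr // ltr1n.
have [/(_ t0) A1 /(_ t0) A2] := Hd _ td.
rewrite addr0; have t20 : 0 < t ^+ 2 by rewrite exprn_gt0.
rewrite -(ler_pM2r t20) -[X in _ * X <= _]gtr0_norm // -normrM.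
move: A1 A2; set D1 := 'D_v _ _; set D2 := 'D_u _ _.
rewrite (_ : x + t *: v + t *: u = x + t *: u + t *: v); last by rewrite addrAC.
set a := f _; set b := f _; set c := f _; move=> A1 A2.
have -> : (D1 - D2) * t ^+ 2 = (a - c - b + f x - t ^+ 2 * D2)
   - (a - b - c + f x - t ^+ 2 * D1) by ring.
apply: le_trans (ler_normB _ _) _; apply: le_trans (lerD A2 A1) _.
by rewrite -mulrDl -splitr.
Qed.

End Schwarz.

(** * Functions on a manifold *)

Section Charts.
Variables (R : realType) (n : nat) (M : manifold R n).
Implicit Types p q r : M.

Lemma chart_dom_near p q : chart_dom p q -> \forall r \near q, chart_dom p r.
Proof. by move=> pq; apply: open_nbhs_nbhs; split => //; exact: chart_dom_open. Qed.

Lemma near_chart_inv (P : M -> Prop) p q : chart_dom p q ->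
  (\forall r \near q, P r) -> \forall x \near chart p q, P (chart_inv p x).
Proof.
move=> pq nP; apply: (@chart_inv_cont _ _ M p (chart p q)); first by exists q.
by rewrite chartK.
Qed.

Lemma near_chart (P : 'rV[R]_n -> Prop) p q : chart_dom p q ->
  (\forall x \near chart p q, P x) -> \forall r \near q, P (chart p r).
Proof. by move=> pq nP; apply: (@chart_cont _ _ M p q pq). Qed.

Lemma chart_invK_near p q : chart_dom p q ->
  \forall x \near chart p q, chart p (chart_inv p x) = x.
Proof.
move=> pq; have : nbhs (chart p q) (chart p @` chart_dom p).
  by apply: open_nbhs_nbhs; split; [exact: chart_im_open|exists q].
by apply: filterS => _ [r pr <-]; rewrite chartK.
Qed.

Lemma coord_id p v : coord p p v = v.
Proof.
rewrite /coord (@near_eq_diff _ _ _ id) //; first by rewrite diff_val.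
by apply: filterS (chart_invK_near (chart_dom_mem p)) => x /= ->.
Qed.

(** The cocycle rule for chart transitions, by which components in two charts around [r] are
    converted into each other. *)
Lemma transition_diff p q r v : chart_dom p r -> chart_dom q r ->
  'd (chart q \o chart_inv p) (chart p r) (coord p r v) = coord q r v.
Proof.
move=> pr qr; rewrite /coord.
have sp := smooth_at_diff (chart_smooth (chart_dom_mem r) pr).
have sq := smooth_at_diff (chart_smooth pr qr).
have E : chart p (chart_inv r (chart r r)) = chart p r.
  by rewrite chartK //; exact: chart_dom_mem.
apply: etrans (diff_comp_app v E sp sq) _.
apply/esym/near_eq_diff_app; last first.
  exact: differentiable_comp_at E sp sq.
have := near_chart_inv (chart_dom_mem r) (chart_dom_near pr).
by apply: filterS => x px /=; rewrite chartK.
Qed.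

Lemma extE p q v : chart_dom p q -> coord p q (ext p v q) = v.
Proof.
move=> pq; have sp := smooth_at_diff (chart_smooth pq (chart_dom_mem q)).
have sq := smooth_at_diff (chart_smooth (chart_dom_mem q) pq).
have E : chart q (chart_inv p (chart p q)) = chart q q by rewrite chartK.
apply: etrans (diff_comp_app v E sp sq) _.
apply: etrans (near_eq_diff_app (f := id) _ _ _) _ => //; last by rewrite diff_val.
have := near_chart_inv pq (chart_dom_near (chart_dom_mem q)).
apply: filterS2 (chart_invK_near pq) => x K qx /=.
by rewrite (chartK qx) K.
Qed.

Lemma coordK p q v : chart_dom p q -> ext p (coord p q v) q = v.
Proof.
by move=> pq; rewrite /ext (transition_diff _ pq) ?coord_id //; exact: chart_dom_mem.
Qed.

Lemma ext_id p v : ext p v p = v.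
Proof. exact: coord_id. Qed.

Lemma coordD p q u v : coord p q (u + v) = coord p q u + coord p q v.
Proof. by rewrite /coord linearD. Qed.

Lemma coordZ p q a v : coord p q (a *: v) = a *: coord p q v.
Proof. by rewrite /coord linearZ. Qed.

Lemma extD p q u v : ext p (u + v) q = ext p u q + ext p v q.
Proof. by rewrite /ext linearD. Qed.

Lemma extZ p q a v : ext p (a *: v) q = a *: ext p v q.
Proof. by rewrite /ext linearZ. Qed.

Lemma ext_sum p q v : ext p v q = \sum_b v 0 b *: ext p (delta_mx 0 b) q.
Proof.
rewrite {1}(row_sum_delta v) /ext linear_sum.
by apply: eq_bigr => b _; rewrite linearZ.
Qed.

Section Functions.
Variable W : normedModType R.
Implicit Types f h : M -> W.

Lemma msmooth_eq f h p : {near p, f =1 h} -> msmooth_at f p -> msmooth_at h p.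
Proof. by move=> fh; apply: smooth_at_eq; exact: near_chart_inv (chart_dom_mem p) fh. Qed.

Lemma msmooth_cst (a : W) p : msmooth_at (fun _ : M => a) p.
Proof. exact: smooth_at_cst. Qed.

Lemma msmooth_diff f p : msmooth_at f p -> differentiable (f \o chart_inv p) (chart p p).
Proof. exact: smooth_at_diff. Qed.

Lemma mdiff_eq f h p v : {near p, f =1 h} -> msmooth_at f p ->
  mdiff h p v = mdiff f p v.
Proof.
move=> fh /msmooth_diff sf; apply: near_eq_diff_app sf.
exact: near_chart_inv (chart_dom_mem p) fh.
Qed.

Lemma mdiff_cst (a : W) p v : mdiff (fun _ : M => a) p v = 0.
Proof. by rewrite /mdiff (diff_cst a). Qed.

Lemma mdiffDv f p u v : mdiff f p (u + v) = mdiff f p u + mdiff f p v.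
Proof. by rewrite /mdiff linearD. Qed.

Lemma mdiffZv f p a v : mdiff f p (a *: v) = a *: mdiff f p v.
Proof. by rewrite /mdiff linearZ. Qed.

Lemma mdiffD f h p v : msmooth_at f p -> msmooth_at h p ->
  mdiff (fun q => f q + h q) p v = mdiff f p v + mdiff h p v.
Proof. by move=> /msmooth_diff df /msmooth_diff dh; exact: diffD_app df dh. Qed.

End Functions.

Lemma msmooth_rVP k (f : M -> 'rV[R]_k) p :
  msmooth_at f p <-> forall b, msmooth_at (fun q => f q 0 b) p.
Proof. exact: smooth_at_rVP. Qed.

Lemma mdiff_rV k (f : M -> 'rV[R]_k) p v b : msmooth_at f p ->
  mdiff f p v 0 b = mdiff (fun q => f q 0 b) p v.
Proof.
move=> /msmooth_diff df; rewrite /mdiff -!deriveE ?derive_comp_rV //.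
exact: (@differentiable_comp_rV _ _ _ (f \o chart_inv p)).
Qed.

Section Scalars.
Implicit Types f h : M -> R.

Lemma msmoothD f h p : msmooth_at f p -> msmooth_at h p -> msmooth_at (fun q => f q + h q) p.
Proof. exact: smooth_atD. Qed.

Lemma msmoothM f h p : msmooth_at f p -> msmooth_at h p -> msmooth_at (fun q => f q * h q) p.
Proof. exact: smooth_atM. Qed.

Lemma msmoothV f p : msmooth_at f p -> f p != 0 -> msmooth_at (fun q => (f q)^-1) p.
Proof.
by move=> sf fp; apply: smooth_atV => //=; rewrite chartK //; exact: chart_dom_mem.
Qed.

Lemma msmooth_comp k (f : 'rV[R]_k -> R) (h : M -> 'rV[R]_k) p :
  smooth_at f (h p) -> msmooth_at h p -> msmooth_at (fun q => f (h q)) p.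
Proof.
move=> sf sh; have E : h (chart_inv p (chart p p)) = h p.
  by rewrite chartK //; exact: chart_dom_mem.
by rewrite -E in sf; exact: smooth_at_comp sf sh.
Qed.

Lemma mdiffM f h p v : msmooth_at f p -> msmooth_at h p ->
  mdiff (fun q => f q * h q) p v = f p * mdiff h p v + h p * mdiff f p v.
Proof.
move=> /msmooth_diff df /msmooth_diff dh; apply: etrans (diffM_app v df dh) _.
by rewrite /= chartK //; exact: chart_dom_mem.
Qed.

Lemma msmooth_sum (I : Type) (s : seq I) (f : I -> M -> R) p :
  (forall i, msmooth_at (f i) p) -> msmooth_at (fun q => \sum_(i <- s) f i q) p.
Proof.
move=> sf; elim: s => [|i s IH].
  by under eq_fun do rewrite big_nil; exact: msmooth_cst.
by under eq_fun do rewrite big_cons; exact: msmoothD.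
Qed.

Lemma mdiff_sum (I : Type) (s : seq I) (f : I -> M -> R) p v :
  (forall i, msmooth_at (f i) p) ->
  mdiff (fun q => \sum_(i <- s) f i q) p v = \sum_(i <- s) mdiff (f i) p v.
Proof.
move=> sf; elim: s => [|i s IH].
  by under eq_fun do rewrite big_nil; rewrite mdiff_cst big_nil.
under eq_fun do rewrite big_cons.
by rewrite mdiffD ?big_cons ?IH //; exact: msmooth_sum.
Qed.

(** [msmooth_at] refers to a different chart at each point. Smoothness of the transition maps allows
    one chart to serve for a whole neighbourhood. *)
Lemma msmooth_change f p q r : chart_dom p r -> chart_dom q r ->
  smooth_at (f \o chart_inv p) (chart p r) -> smooth_at (f \o chart_inv q) (chart q r).
Proof.
move=> pr qr sf.
have : smooth_at (fun x => (f \o chart_inv p) ((chart p \o chart_inv q) x)) (chart q r).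
  by apply: smooth_at_comp; [rewrite /= chartK|exact: chart_smooth].
apply: smooth_at_eq; have := near_chart_inv qr (chart_dom_near pr).
by apply: filterS => x px /=; rewrite chartK.
Qed.

Lemma msmooth_near f p : msmooth_at f p -> \forall q \near p, msmooth_at f q.
Proof.
move=> /smooth_at_near /(near_chart (chart_dom_mem p)).
apply: filterS2 (chart_dom_near (chart_dom_mem p)) => q pq.
by apply: msmooth_change => //; exact: chart_dom_mem.
Qed.

(** Expressing the differentials at nearby points in one chart makes them a function on a vector
    space, which can be differentiated again. *)
Lemma mdiff_chart f p q v : chart_dom p q -> msmooth_at f q ->
  mdiff f q v = 'd (f \o chart_inv p) (chart p q) (coord p q v).
Proof.
move=> pq sf; have dp := smooth_at_diff (msmooth_change (chart_dom_mem q) pq sf).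
have dt := smooth_at_diff (chart_smooth (chart_dom_mem q) pq).
have E : chart p (chart_inv q (chart q q)) = chart p q.
  by rewrite chartK //; exact: chart_dom_mem.
apply/esym; apply: etrans (diff_comp_app v E dt dp) _.
apply/esym/near_eq_diff_app; last first.
  exact: differentiable_comp_at E dt dp.
have := near_chart_inv (chart_dom_mem q) (chart_dom_near pq).
by apply: filterS => x px /=; rewrite chartK.
Qed.

Lemma msmooth_mdiff f U p : msmooth_at f p -> vsmooth_at U p ->
  msmooth_at (fun q => mdiff f q (U q)) p.
Proof.
move=> sf sU.
apply: (@msmooth_eq _ (fun q => \sum_b coord p q (U q) 0 b *
  'D_(delta_mx 0 b) (f \o chart_inv p) (chart p q))).
  apply: filterS2 (chart_dom_near (chart_dom_mem p)) (msmooth_near sf) => q pq sq.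
  rewrite (mdiff_chart _ pq sq) [in RHS](row_sum_delta (coord p q (U q))) linear_sum.
  apply: eq_bigr => b _; rewrite linearZ; congr (_ *: _); apply: deriveE.
  exact: smooth_at_diff (msmooth_change (chart_dom_mem q) pq sq).
apply: msmooth_sum => b; apply: msmoothM; first exact: ((msmooth_rVP _ _).1 sU b).
apply: (@smooth_at_eq _ _ _ (fun x => 'D_(delta_mx 0 b) (f \o chart_inv p) x)).
  by apply: filterS (chart_invK_near (chart_dom_mem p)) => x /= ->.
exact: smooth_at_derive.
Qed.

(** Both fields have constant components in the chart at [p], so this is Schwarz's theorem for [F].
    All later commutations of derivatives rest on it. *)
Lemma mdiff_sym f p q u v : chart_dom p q -> msmooth_at f q ->
  mdiff (fun r => mdiff f r (ext p u r)) q (ext p v q) =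
  mdiff (fun r => mdiff f r (ext p v r)) q (ext p u q).
Proof.
move=> pq sf; pose F := f \o chart_inv p.
have sF : smooth_at F (chart p q) by exact: msmooth_change (chart_dom_mem q) pq sf.
have E w : {near q, (fun r => 'D_w F (chart p r)) =1 fun r => mdiff f r (ext p w r)}.
  apply: filterS2 (chart_dom_near pq) (msmooth_near sf) => r pr sr.
  rewrite (mdiff_chart _ pr sr) extE //; apply: deriveE.
  exact: smooth_at_diff (msmooth_change (chart_dom_mem r) pr sr).
have E' w : {near chart p q, (fun x => 'D_w F x) =1
    (fun r => 'D_w F (chart p r)) \o chart_inv p}.
  by apply: filterS (chart_invK_near pq) => x /= ->.
have S w : msmooth_at (fun r => 'D_w F (chart p r)) q.
  apply: (msmooth_change pq (chart_dom_mem q)); apply: smooth_at_eq (E' w) _.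
  exact: smooth_at_derive.
have D w z : mdiff (fun r => mdiff f r (ext p w r)) q (ext p z q) =
    'D_z (fun x => 'D_w F x) (chart p q).
  rewrite (mdiff_eq _ (E w) (S w)) (mdiff_chart _ pq (S w)) (extE _ pq).
  have dw := smooth_at_diff (smooth_at_derive w sF).
  apply: etrans (near_eq_diff_app _ (E' w) dw) _.
  by apply/esym/deriveE.
rewrite !D derive_sym //; try by apply/smooth_at_diff/smooth_at_derive.
by apply: filterS (smooth_at_near sF) => x; exact: smooth_at_diff.
Qed.

End Scalars.

End Charts.

(** * The metric and vector fields along a map *)

Section Metric.
Variables (R : realType) (n : nat) (M : manifold R n) (g : riemannian M).
Implicit Types (p : M) (u v w : 'rV[R]_n) (a : R).

Lemma metricDl p u v w : metric g p (u + v) w = metric g p u w + metric g p v w.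
Proof. by rewrite /metric !mulmxDl mxE. Qed.

Lemma metricZl p a u w : metric g p (a *: u) w = a * metric g p u w.
Proof. by rewrite /metric -!scalemxAl mxE. Qed.

Lemma metric_sym p u v : metric g p u v = metric g p v u.
Proof.
rewrite /metric -[in RHS](gram_sym g p).
transitivity ((u *m g p *m v^T)^T 0 0); first by rewrite [RHS]mxE.
by rewrite !trmx_mul trmxK mulmxA.
Qed.

Lemma metricDr p u v w : metric g p w (u + v) = metric g p w u + metric g p w v.
Proof. by rewrite !(metric_sym _ w) metricDl. Qed.

Lemma metricZr p a u w : metric g p w (a *: u) = a * metric g p w u.
Proof. by rewrite !(metric_sym _ w) metricZl. Qed.

Lemma metric0l p w : metric g p 0 w = 0.
Proof. by rewrite -(scale0r 0) metricZl mul0r. Qed.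

Lemma metric0r p w : metric g p w 0 = 0.
Proof. by rewrite metric_sym metric0l. Qed.

Lemma metricNl p u w : metric g p (- u) w = - metric g p u w.
Proof. by rewrite -scaleN1r metricZl mulN1r. Qed.

Lemma metricBl p u v w : metric g p (u - v) w = metric g p u w - metric g p v w.
Proof. by rewrite metricDl metricNl. Qed.

Lemma metric_suml (I : Type) (s : seq I) (u : I -> 'rV[R]_n) p w :
  metric g p (\sum_(i <- s) u i) w = \sum_(i <- s) metric g p (u i) w.
Proof.
elim: s => [|i s IH]; first by rewrite !big_nil metric0l.
by rewrite !big_cons metricDl IH.
Qed.

Lemma metric_sumr (I : Type) (s : seq I) (u : I -> 'rV[R]_n) p w :
  metric g p w (\sum_(i <- s) u i) = \sum_(i <- s) metric g p w (u i).
Proof.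
by rewrite metric_sym metric_suml; apply: eq_bigr => i _; rewrite metric_sym.
Qed.

Lemma metric_nondeg p u : (forall v, metric g p u v = 0) -> u = 0.
Proof.
move=> u0; apply/eqP/negPn/negP => /(gram_pos g p).
by rewrite -[X in 0 < X]/(metric g p u u) u0 ltxx.
Qed.

End Metric.

Section AlongMap.
Variables (R : realType) (m k : nat) (M : manifold R m) (N : manifold R k).
Variable psi : M -> N.
Implicit Types (p q : M) (V W : M -> 'rV[R]_k).

(** For [psi] the identity this is convertible to [vsmooth_at], so facts about vector fields are
    obtained below as instances at [id]. *)
Definition along_smooth_at V p : Prop :=
  msmooth_at (fun q => coord (psi p) (psi q) (V q)) p.

Lemma along_smooth_eq V W p : {near p, V =1 W} ->
  along_smooth_at V p -> along_smooth_at W p.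
Proof. by move=> VW; apply: msmooth_eq; apply: filterS VW => q /= ->. Qed.

Lemma along_smooth0 p : along_smooth_at (fun _ => 0) p.
Proof.
apply: (@msmooth_eq _ _ _ _ (fun _ => 0)); last exact: msmooth_cst.
by apply: nearW => q; rewrite /coord linear0.
Qed.

Lemma along_smooth_comp V p b : along_smooth_at V p ->
  msmooth_at (fun q => coord (psi p) (psi q) (V q) 0 b) p.
Proof. by move=> sV; exact: ((msmooth_rVP _ _).1 sV b). Qed.

Lemma along_smoothD V W p : along_smooth_at V p -> along_smooth_at W p ->
  along_smooth_at (fun q => V q + W q) p.
Proof.
move=> sV sW; apply/msmooth_rVP => b.
apply: msmooth_eq (msmoothD (along_smooth_comp b sV) (along_smooth_comp b sW)).
by apply: nearW => q; rewrite coordD mxE.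
Qed.

Lemma along_smoothZ (f : M -> R) V p : msmooth_at f p -> along_smooth_at V p ->
  along_smooth_at (fun q => f q *: V q) p.
Proof.
move=> sf sV; apply/msmooth_rVP => b.
apply: msmooth_eq (msmoothM sf (along_smooth_comp b sV)).
by apply: nearW => q; rewrite coordZ mxE.
Qed.

Lemma along_smooth_sum (I : Type) (s : seq I) (V : I -> M -> 'rV[R]_k) p :
  (forall i, along_smooth_at (V i) p) ->
  along_smooth_at (fun q => \sum_(i <- s) V i q) p.
Proof.
move=> sV; elim: s => [|i s IH].
  by under eq_fun do rewrite big_nil; exact: along_smooth0.
by under eq_fun do rewrite big_cons; exact: along_smoothD.
Qed.

Hypothesis psi_cont : continuous psi.
Hypothesis psi_smooth : forall p, msmooth_at (fun q => chart (psi p) (psi q)) p.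

Lemma map_chart_near p o : chart_dom o (psi p) ->
  \forall q \near p, chart_dom o (psi q).
Proof. by move=> /chart_dom_near; apply: psi_cont. Qed.

Lemma map_chart_near_id p : \forall q \near p, chart_dom (psi p) (psi q).
Proof. exact/map_chart_near/chart_dom_mem. Qed.

Lemma map_smooth o p : chart_dom o (psi p) ->
  msmooth_at (fun q => chart o (psi q)) p.
Proof.
move=> op; apply/msmooth_rVP => b.
apply: (@msmooth_eq _ _ _ _ (fun q =>
  (chart o (chart_inv (psi p) (chart (psi p) (psi q)))) 0 b)).
  by apply: filterS (map_chart_near_id p) => q pq; rewrite chartK.
apply: (@msmooth_comp _ _ _ _ (fun x => (chart o \o chart_inv (psi p)) x 0 b)
  (fun q => chart (psi p) (psi q))) => //.
by apply: ((smooth_at_rVP _ _).1 _ b); apply: chart_smooth => //; exact: chart_dom_mem.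
Qed.

Lemma msmooth_pull (f : N -> R) p : msmooth_at f (psi p) ->
  msmooth_at (fun q => f (psi q)) p.
Proof.
move=> sf; have := @msmooth_comp _ _ _ _ (f \o chart_inv (psi p)) _ p sf (psi_smooth p).
apply: msmooth_eq.
by apply: filterS (map_chart_near_id p) => q pq /=; rewrite chartK.
Qed.

Lemma psi_diff p : differentiable (chart (psi p) \o psi \o chart_inv p) (chart p p).
Proof. exact: msmooth_diff (psi_smooth p). Qed.

Lemma psi_chart p : (chart (psi p) \o psi \o chart_inv p) (chart p p) = chart (psi p) (psi p).
Proof. by rewrite /= (chartK (chart_dom_mem p)). Qed.

Lemma mdiff_pull (f : N -> R) p u : msmooth_at f (psi p) ->
  mdiff (fun q => f (psi q)) p u = mdiff f (psi p) (dmap psi p u).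
Proof.
move=> sf; apply/esym.
apply: etrans (diff_comp_app u (psi_chart p) (psi_diff p) (msmooth_diff sf)) _.
apply/esym/near_eq_diff_app; last first.
  exact: differentiable_comp_at (psi_chart p) (psi_diff p) (msmooth_diff sf).
have := near_chart_inv (chart_dom_mem p) (map_chart_near_id p).
by apply: filterS => x px /=; rewrite chartK.
Qed.

Lemma coord_dmap p q u : chart_dom (psi p) (psi q) ->
  coord (psi p) (psi q) (dmap psi q u) = mdiff (fun r => chart (psi p) (psi r)) q u.
Proof.
move=> pq; have ds := smooth_at_diff (chart_smooth (chart_dom_mem (psi q)) pq).
apply: etrans (diff_comp_app u (psi_chart q) (psi_diff q) ds) _.
apply/esym/near_eq_diff_app; last exact: differentiable_comp_at (psi_chart q) (psi_diff q) ds.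
have := near_chart_inv (chart_dom_mem q) (map_chart_near_id q).
by apply: filterS => x px /=; rewrite chartK.
Qed.

Lemma dmapD p u v : dmap psi p (u + v) = dmap psi p u + dmap psi p v.
Proof. by rewrite /dmap linearD. Qed.

Lemma dmapZ p (a : R) u : dmap psi p (a *: u) = a *: dmap psi p u.
Proof. by rewrite /dmap linearZ. Qed.

Lemma dmap0 p : dmap psi p 0 = 0.
Proof. by rewrite /dmap linear0. Qed.

Lemma dmap_sum (I : Type) (s : seq I) (u : I -> 'rV[R]_m) p :
  dmap psi p (\sum_(i <- s) u i) = \sum_(i <- s) dmap psi p (u i).
Proof. by rewrite /dmap linear_sum. Qed.

(** Reduces a field along [psi] to scalar functions on M times coordinate fields pulled back from N.
    Only the latter can be handed to the connection of N. *)
Lemma along_frame V p : {near p, (fun q => \sum_b coord (psi p) (psi q) (V q) 0 b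
    *: ext (psi p) (delta_mx 0 b) (psi q)) =1 V}.
Proof.
by apply: filterS (map_chart_near_id p) => q pq; rewrite -ext_sum coordK.
Qed.

Lemma along_smooth_near V p : along_smooth_at V p ->
  \forall q \near p, along_smooth_at V q.
Proof.
move=> sV; have : \forall q \near p, forall b,
    msmooth_at (fun r => coord (psi p) (psi r) (V r) 0 b) q.
  by apply: filter_forall => b; apply: msmooth_near; exact: along_smooth_comp.
apply: filterS2 (map_chart_near_id p) => q pq sq; apply/msmooth_rVP => c.
(* These are the entries of the Jacobian of the transition from the chart at [psi p] to the chart at
   [psi q], evaluated along [psi]. *)
have sT b : msmooth_at (fun r => 'D_(delta_mx 0 b) (chart (psi q) \o chart_inv (psi p))
    (chart (psi p) (psi r)) 0 c) q.
  apply: (@msmooth_comp _ _ _ _ (fun x => 'D_(delta_mx 0 b)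
    (chart (psi q) \o chart_inv (psi p)) x 0 c) (fun r => chart (psi p) (psi r))).
    apply: ((smooth_at_rVP _ _).1 _ c); apply: smooth_at_derive.
    by apply: chart_smooth => //; exact: chart_dom_mem.
  exact: map_smooth.
have := msmooth_sum (index_enum _) (fun b => msmoothM (sq b) (sT b)).
apply: msmooth_eq; apply: filterS2 (map_chart_near_id q) (map_chart_near pq) => r qr pr.
rewrite -(transition_diff _ pr qr) (row_sum_delta (coord (psi p) (psi r) (V r))).
rewrite linear_sum summxE; apply: eq_bigr => b _.
rewrite linearZ !mxE -row_sum_delta; congr (_ * _).
by rewrite deriveE //; exact: smooth_at_diff (chart_smooth pr qr).
Qed.

Lemma along_smooth_pull (Y : N -> 'rV[R]_k) p : vsmooth_at Y (psi p) ->
  along_smooth_at (fun q => Y (psi q)) p.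
Proof.
move=> sY; apply/msmooth_rVP => b.
by apply: (@msmooth_pull (fun y => coord (psi p) y (Y y) 0 b)); exact: ((msmooth_rVP _ _).1 sY b).
Qed.

Lemma along_smooth_dmap (U : M -> 'rV[R]_m) p : vsmooth_at U p ->
  along_smooth_at (fun q => dmap psi q (U q)) p.
Proof.
move=> sU; apply/msmooth_rVP => b.
have sb : msmooth_at (fun q => chart (psi p) (psi q) 0 b) p.
  exact: ((msmooth_rVP _ _).1 (psi_smooth p) b).
apply: msmooth_eq (msmooth_mdiff sb sU).
apply: filterS (map_chart_near_id p) => q pq; rewrite coord_dmap // mdiff_rV //.
exact: map_smooth.
Qed.

End AlongMap.

(** * Vector fields as fields along the identity, and brackets of coordinate fields *)

Section VectorFields.
Variables (R : realType) (k : nat) (N : manifold R k).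
Implicit Types (p q : N).

Lemma id_smooth p : msmooth_at (fun q : N => chart p q) p.
Proof. by apply: chart_smooth; exact: chart_dom_mem. Qed.

Lemma dmap_id p u : dmap (fun q : N => q) p u = u.
Proof. exact: coord_id. Qed.

Lemma vsmooth_near (Y : N -> 'rV[R]_k) p : vsmooth_at Y p -> \forall q \near p, vsmooth_at Y q.
Proof. exact: (@along_smooth_near _ _ _ N N id (fun=> cvg_id) id_smooth). Qed.

Lemma vsmooth_ext_dom p q v : chart_dom p q -> vsmooth_at (ext p v) q.
Proof.
move=> pq; have qq := chart_dom_mem q; apply/msmooth_rVP => c.
have sT : msmooth_at (fun r => 'D_v (chart q \o chart_inv p) (chart p r) 0 c) q.
  apply: (@msmooth_comp _ _ _ _ (fun x => 'D_v (chart q \o chart_inv p) x 0 c)).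
    by apply: ((smooth_at_rVP _ _).1 _ c); apply: smooth_at_derive; exact: chart_smooth.
  exact: chart_smooth.
apply: msmooth_eq sT; apply: filterS2 (chart_dom_near pq) (chart_dom_near qq) => r pr qr.
rewrite -(transition_diff _ pr qr) (extE _ pr) deriveE //.
exact: smooth_at_diff (chart_smooth pr qr).
Qed.

Lemma vsmooth_ext p v : vsmooth_at (ext p v) p.
Proof. exact: vsmooth_ext_dom (chart_dom_mem p). Qed.

(** Component [c] of the bracket is the commutator of two second derivatives of the coordinate
    function with index [c], and [mdiff_sym] applies. *)
Lemma bracket_ext p q u v : chart_dom p q -> bracket (ext p u) (ext p v) q = 0.
Proof.
move=> pq; apply/eqP; rewrite subr_eq0; apply/eqP/rowP => c.
have sc : msmooth_at (fun r => chart q r 0 c) q.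
  exact: ((msmooth_rVP _ _).1 (id_smooth q) c).
have E w : {near q, (fun r => coord q r (ext p w r) 0 c) =1
    fun r => mdiff (fun s => chart q s 0 c) r (ext p w r)}.
  apply: filterS (chart_dom_near (chart_dom_mem q)) => r qr.
  have := @coord_dmap _ _ _ _ _ id (fun=> cvg_id) id_smooth q r (ext p w r) qr.
  rewrite dmap_id => ->; apply: mdiff_rV.
  by apply: chart_smooth => //; exact: chart_dom_mem.
have sE w : msmooth_at (fun r => coord q r (ext p w r)) q by exact: vsmooth_ext_dom.
have D w z : mdiff (fun r => coord q r (ext p w r)) q z 0 c =
    mdiff (fun r => mdiff (fun s => chart q s 0 c) r (ext p w r)) q z.
  rewrite (mdiff_rV _ _ (sE w)); apply/esym/(mdiff_eq _ (E w)).
  exact: ((msmooth_rVP _ _).1 (sE w) c).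
by rewrite !D; exact: mdiff_sym.
Qed.

End VectorFields.

(** * The connection along a map *)

Section Connection.
Variables (R : realType) (k : nat) (N : manifold R k) (nabla : connection N).
Hypothesis affine : is_affine_connection nabla.
Implicit Types (p q : N) (Y Z : N -> 'rV[R]_k).

(* The indicator function of {Y = Z} is smooth at p, which makes the Leibniz
   rule imply that a connection is a local operator. *)
Lemma conn_eq Y Z p v : {near p, Y =1 Z} -> vsmooth_at Y p ->
  nabla p v Z = nabla p v Y.
Proof.
move=> YZ sY; have sZ : vsmooth_at Z p.
  by apply: msmooth_eq sY; apply: filterS YZ => q /= ->.
pose f q : R := if `[< Y q = Z q >] then 1 else 0.
have f1 : {near p, (fun _ => 1) =1 f}.
  by apply: filterS YZ => q /= E; rewrite /f asboolT.
have sf : msmooth_at f p by apply: msmooth_eq f1 _; exact: msmooth_cst.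
have dfv : mdiff f p v = 0 by rewrite (mdiff_eq _ f1) ?mdiff_cst //; exact: msmooth_cst.
have fp : f p = 1 by rewrite -(nbhs_singleton f1).
have E : (fun q => f q *: Y q) = (fun q => f q *: Z q).
  by apply/funext => q; rewrite /f; case: asboolP => [->//|_]; rewrite !scale0r.
have := congr1 (nabla p v) E; rewrite !(conn_leibniz affine) //.
by rewrite dfv fp !scale0r !add0r !scale1r.
Qed.

Lemma connZ (a : R) Y p v : vsmooth_at Y p ->
  nabla p v (fun q => a *: Y q) = a *: nabla p v Y.
Proof.
move=> sY; have := conn_leibniz affine v (msmooth_cst a p) sY.
by rewrite mdiff_cst scale0r add0r.
Qed.

Lemma conn0 p v : nabla p v (fun _ => 0) = 0.
Proof.
have s0 : vsmooth_at (fun _ : N => 0 : 'rV[R]_k) p by exact: (@along_smooth0 _ _ _ _ _ id p).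
by have := connZ 0 v s0; rewrite !scale0r.
Qed.

Lemma conn_sum (I : Type) (s : seq I) (Y : I -> N -> 'rV[R]_k) p v :
  (forall i, vsmooth_at (Y i) p) ->
  nabla p v (fun q => \sum_(i <- s) Y i q) = \sum_(i <- s) nabla p v (Y i).
Proof.
move=> sY; elim: s => [|i s IH].
  by under eq_fun do rewrite big_nil; rewrite big_nil conn0.
under eq_fun do rewrite big_cons.
rewrite (conn_add affine) ?IH ?big_cons //.
exact: (@along_smooth_sum _ _ _ _ _ id).
Qed.

Lemma conn_dirZ (a : R) u Y p : vsmooth_at Y p -> nabla p (a *: u) Y = a *: nabla p u Y.
Proof.
move=> sY; have := conn_linear affine sY (-1) 0 0.
rewrite scaler0 addr0 scaleN1r addNr => n0.
by rewrite -[a *: u]addr0 (conn_linear affine) // n0 addr0.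
Qed.

Lemma conn_dir0 Y p : vsmooth_at Y p -> nabla p 0 Y = 0.
Proof. by move=> sY; have := conn_dirZ 0 0 sY; rewrite !scale0r. Qed.

Lemma conn_dirD u v Y p : vsmooth_at Y p -> nabla p (u + v) Y = nabla p u Y + nabla p v Y.
Proof. by move=> sY; have := conn_linear affine sY 1 u v; rewrite !scale1r. Qed.

Lemma conn_dir_sum (I : Type) (s : seq I) (u : I -> 'rV[R]_k) Y p : vsmooth_at Y p ->
  nabla p (\sum_(i <- s) u i) Y = \sum_(i <- s) nabla p (u i) Y.
Proof.
move=> sY; elim: s => [|i s IH]; first by rewrite !big_nil conn_dir0.
by rewrite !big_cons conn_dirD // IH.
Qed.

End Connection.

Section AlongConnection.
Variables (R : realType) (m k : nat) (M : manifold R m) (N : manifold R k).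
Variables (psi : M -> N) (nabla : connection N).
Hypothesis affine : is_affine_connection nabla.
Hypothesis psi_cont : continuous psi.
Hypothesis psi_smooth : forall p, msmooth_at (fun q => chart (psi p) (psi q)) p.
Implicit Types (p q : M) (V W : M -> 'rV[R]_k) (u v : 'rV[R]_m).

Local Notation D := (along_nabla nabla psi).
Local Notation asmooth := (along_smooth_at psi).

Lemma along_eq V W p u : {near p, V =1 W} -> asmooth V p -> D p u W = D p u V.
Proof.
move=> VW sV; have E : V p = W p := nbhs_singleton VW.
have E' : {near p, (fun q => coord (psi p) (psi q) (V q)) =1
    fun q => coord (psi p) (psi q) (W q)} by apply: filterS VW => q /= ->.
have E2 := mdiff_eq u E' sV.
by rewrite /along_nabla -E E2.
Qed.

Lemma alongD V W p u : asmooth V p -> asmooth W p ->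
  D p u (fun q => V q + W q) = D p u V + D p u W.
Proof.
move=> sV sW.
have E1 : (fun q => coord (psi p) (psi q) (V q + W q)) =
    (fun q => coord (psi p) (psi q) (V q) + coord (psi p) (psi q) (W q)).
  by apply/funext => q; exact: coordD.
have E2 : ext (psi p) (V p + W p) = (fun y => ext (psi p) (V p) y + ext (psi p) (W p) y).
  by apply/funext => y; exact: extD.
have E3 := mdiffD u sV sW.
rewrite /along_nabla E1 E2 E3 (conn_add affine _ (vsmooth_ext _ _) (vsmooth_ext _ _)).
exact: addrACA.
Qed.

Lemma alongZ (f : M -> R) V p u : msmooth_at f p -> asmooth V p ->
  D p u (fun q => f q *: V q) = mdiff f p u *: V p + f p *: D p u V.
Proof.
move=> sf sV; have sfV := along_smoothZ sf sV.
have E1 : mdiff (fun q => coord (psi p) (psi q) (f q *: V q)) p u = mdiff f p u *: V p +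
    f p *: mdiff (fun q => coord (psi p) (psi q) (V q)) p u.
  apply/rowP => b.
  rewrite (mdiff_rV _ _ sfV) [RHS]mxE [X in _ = X + _]mxE [X in _ = _ + X]mxE (mdiff_rV _ _ sV).
  have E : (fun q => coord (psi p) (psi q) (f q *: V q) 0 b) =
      (fun q => f q * coord (psi p) (psi q) (V q) 0 b).
    by apply/funext => q; rewrite coordZ mxE.
  rewrite E (mdiffM u sf (along_smooth_comp b sV)).
  by rewrite coord_id addrC (mulrC (V p 0 b)).
have E2 : ext (psi p) (f p *: V p) = (fun y => f p *: ext (psi p) (V p) y).
  by apply/funext => y; exact: extZ.
rewrite /along_nabla E1 E2 (connZ affine _ _ (vsmooth_ext _ _)) -addrA -scalerDr.
by [].
Qed.

Lemma along0 p u : D p u (fun _ => 0) = 0.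
Proof.
have := @alongZ (fun _ => 0) (fun _ => 0) p u (msmooth_cst _ _) (along_smooth0 _ _).
by rewrite mdiff_cst !scale0r addr0.
Qed.

Lemma along_sum (I : Type) (s : seq I) (V : I -> M -> 'rV[R]_k) p u :
  (forall i, asmooth (V i) p) ->
  D p u (fun q => \sum_(i <- s) V i q) = \sum_(i <- s) D p u (V i).
Proof.
move=> sV; elim: s => [|i s IH].
  by under eq_fun do rewrite big_nil; rewrite big_nil along0.
under eq_fun do rewrite big_cons.
by rewrite alongD ?IH ?big_cons //; exact: along_smooth_sum.
Qed.

Lemma along_sumZ (s : seq 'I_k) (f : 'I_k -> M -> R) (V : 'I_k -> M -> 'rV[R]_k) p u :
  (forall i, msmooth_at (f i) p) -> (forall i, asmooth (V i) p) ->
  D p u (fun q => \sum_(i <- s) f i q *: V i q) =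
  \sum_(i <- s) (mdiff (f i) p u *: V i p + f i p *: D p u (V i)).
Proof.
move=> sf sV; have sfV i := along_smoothZ (sf i) (sV i).
rewrite (along_sum _ _ sfV); apply: eq_bigr => i _; exact: alongZ.
Qed.

Lemma along_dirD V p u v : D p (u + v) V = D p u V + D p v V.
Proof.
rewrite /along_nabla mdiffDv dmapD (conn_dirD affine _ _ (vsmooth_ext _ _)).
exact: addrACA.
Qed.

Lemma along_dirZ (a : R) V p u : D p (a *: u) V = a *: D p u V.
Proof.
rewrite /along_nabla mdiffZv dmapZ (conn_dirZ affine _ _ (vsmooth_ext _ _)).
by rewrite -scalerDr.
Qed.

Lemma along_dir0 V p : D p 0 V = 0.
Proof. by rewrite -[in LHS](scale0r 0) along_dirZ scale0r. Qed.

Lemma along_dir_sum (I : Type) (s : seq I) (u : I -> 'rV[R]_m) V p :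
  D p (\sum_(i <- s) u i) V = \sum_(i <- s) D p (u i) V.
Proof.
elim: s => [|i s IH]; first by rewrite !big_nil along_dir0.
by rewrite !big_cons along_dirD IH.
Qed.

(** Expanding [Y] in the coordinate frame and applying the Leibniz rule on N produces exactly the
    two terms of [along_nabla]. This links the derivative along the map to the axioms of the
    connection. *)
Lemma along_pull (Y : N -> 'rV[R]_k) p u : vsmooth_at Y (psi p) ->
  D p u (fun q => Y (psi q)) = nabla (psi p) (dmap psi p u) Y.
Proof.
move=> sY; have sc b : msmooth_at (fun y => coord (psi p) y (Y y) 0 b) (psi p).
  exact: ((msmooth_rVP _ _).1 sY b).
have E : {near psi p, (fun y => \sum_b coord (psi p) y (Y y) 0 b
    *: ext (psi p) (delta_mx 0 b) y) =1 Y}.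
  apply: filterS (chart_dom_near (chart_dom_mem (psi p))) => y py.
  by rewrite -ext_sum coordK.
have sE b : vsmooth_at (fun y => coord (psi p) y (Y y) 0 b
    *: ext (psi p) (delta_mx 0 b) y) (psi p).
  exact: (@along_smoothZ _ _ _ _ _ id _ _ _ (sc b) (vsmooth_ext _ _)).
rewrite (conn_eq affine _ E) ?(conn_sum affine _ _ sE); last first.
  exact: (@along_smooth_sum _ _ _ _ _ id _ _ _ _ sE).
rewrite (eq_bigr _ (fun b _ => conn_leibniz affine _ (sc b) (vsmooth_ext _ _))).
rewrite big_split /= /along_nabla; congr (_ + _).
  rewrite [LHS]row_sum_delta; apply: eq_bigr => b _; rewrite ext_id; congr (_ *: _).
  rewrite mdiff_rV; first exact: (mdiff_pull psi_cont psi_smooth u (sc b)).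
  exact: (along_smooth_pull psi_cont psi_smooth sY).
rewrite (_ : ext (psi p) (Y (psi p)) =
    fun y => \sum_b Y (psi p) 0 b *: ext (psi p) (delta_mx 0 b) y); last first.
  by apply/funext => y; rewrite ext_sum.
have sZ b : vsmooth_at (fun y => Y (psi p) 0 b *: ext (psi p) (delta_mx 0 b) y) (psi p).
  exact: (@along_smoothZ _ _ _ _ _ id _ _ _ (msmooth_cst _ _) (vsmooth_ext _ _)).
rewrite (conn_sum affine _ _ sZ); apply: eq_bigr => b _.
by rewrite coord_id (connZ affine) //; exact: vsmooth_ext.
Qed.

Lemma near_pull (P : N -> Prop) p : (\forall y \near psi p, P y) ->
  \forall q \near p, P (psi q).
Proof. by move=> nP; apply: (psi_cont nP). Qed.

Lemma vsmooth_ext_near p (w : 'rV[R]_k) :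
  \forall q \near p, vsmooth_at (ext (psi p) w) (psi q).
Proof. exact: near_pull (vsmooth_near (vsmooth_ext (psi p) w)). Qed.

Lemma along_frame_smooth p b : asmooth (fun q => ext (psi p) (delta_mx 0 b) (psi q)) p.
Proof. by apply: along_smooth_pull => //; exact: vsmooth_ext. Qed.

(** The definition of [along_nabla] at [q] uses the chart at [psi q]. Here the frame at [psi p]
    serves for all [q] near [p], so that the result can be differentiated a second time. *)
Lemma along_expand V p : asmooth V p -> \forall q \near p, forall u,
  D q u V = \sum_b (mdiff (fun r => coord (psi p) (psi r) (V r) 0 b) q u
       *: ext (psi p) (delta_mx 0 b) (psi q)
    + coord (psi p) (psi q) (V q) 0 b
       *: nabla (psi q) (dmap psi q u) (ext (psi p) (delta_mx 0 b))).
Proof.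
move=> sV.
have s1 : \forall q \near p, forall b,
    msmooth_at (fun r => coord (psi p) (psi r) (V r) 0 b) q.
  by apply: filter_forall => b; apply: msmooth_near; exact: along_smooth_comp.
have s2 : \forall q \near p, forall b, vsmooth_at (ext (psi p) (delta_mx 0 b)) (psi q).
  by apply: filter_forall => b; exact: vsmooth_ext_near.
have E := near_join (along_frame psi_cont V p).
near=> q => u.
have q1 : forall b, msmooth_at (fun r => coord (psi p) (psi r) (V r) 0 b) q by near: q.
have q2 : forall b, vsmooth_at (ext (psi p) (delta_mx 0 b)) (psi q) by near: q.
have q3 b := along_smooth_pull psi_cont psi_smooth (q2 b).
rewrite (along_eq u (near E q _)) //.
  by rewrite along_sumZ //; apply: eq_bigr => b _; rewrite along_pull.
by apply: along_smooth_sum => b; exact: along_smoothZ.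
Unshelve. all: by end_near. Qed.

Lemma conn_expand p b : \forall q \near p, forall u,
  nabla (psi q) (dmap psi q u) (ext (psi p) (delta_mx 0 b)) =
  \sum_c coord (psi p) (psi q) (dmap psi q u) 0 c *:
    nabla (psi q) (ext (psi p) (delta_mx 0 c) (psi q)) (ext (psi p) (delta_mx 0 b)).
Proof.
apply: filterS2 (map_chart_near_id psi_cont p) (vsmooth_ext_near p (delta_mx 0 b)).
move=> q pq sq u; rewrite -[in LHS](coordK (dmap psi q u) pq) ext_sum.
by rewrite (conn_dir_sum affine) //; apply: eq_bigr => c _; rewrite (conn_dirZ affine).
Qed.

Lemma vsmooth_conn_ext (o : N) (w z : 'rV[R]_k) :
  vsmooth_at (fun y => nabla y (ext o w y) (ext o z)) o.
Proof. by apply: (conn_smooth affine); exact: vsmooth_ext. Qed.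

(** Once the direction [dmap psi q (U q)] is expanded in the frame as well, the connection enters
    only through pullbacks of fields on N, whose smoothness is [conn_smooth]. *)
Lemma along_smooth_nabla (U : M -> 'rV[R]_m) V p : vsmooth_at U p -> asmooth V p ->
  asmooth (fun q => D q (U q) V) p.
Proof.
move=> sU sV.
pose F q := \sum_b (mdiff (fun r => coord (psi p) (psi r) (V r) 0 b) q (U q)
       *: ext (psi p) (delta_mx 0 b) (psi q)
    + coord (psi p) (psi q) (V q) 0 b *:
    \sum_c coord (psi p) (psi q) (dmap psi q (U q)) 0 c *:
    nabla (psi q) (ext (psi p) (delta_mx 0 c) (psi q)) (ext (psi p) (delta_mx 0 b))).
apply: (@along_smooth_eq _ _ _ _ _ _ F).
  have H : \forall q \near p, forall b u,
    nabla (psi q) (dmap psi q u) (ext (psi p) (delta_mx 0 b)) =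
    \sum_c coord (psi p) (psi q) (dmap psi q u) 0 c *:
    nabla (psi q) (ext (psi p) (delta_mx 0 c) (psi q)) (ext (psi p) (delta_mx 0 b)).
    by apply: filter_forall => b; exact: conn_expand.
  apply: filterS2 (along_expand sV) H => q E1 E2.
  by rewrite E1; apply: eq_bigr => b _; rewrite E2.
apply: along_smooth_sum => b; apply: along_smoothD; apply: along_smoothZ.
- by apply: msmooth_mdiff => //; exact: along_smooth_comp.
- exact: along_frame_smooth.
- exact: along_smooth_comp.
apply: along_smooth_sum => c; apply: along_smoothZ.
  by apply: along_smooth_comp; exact: along_smooth_dmap.
exact: (along_smooth_pull psi_cont psi_smooth (vsmooth_conn_ext _ _ _)).
Qed.

End AlongConnection.

(** * Metric compatibility, torsion and curvature along a map *)

Section AlongLeviCivita.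
Variables (R : realType) (m k : nat) (M : manifold R m) (N : manifold R k).
Variables (psi : M -> N) (g : riemannian N) (nabla : connection N).
Hypothesis lc : is_levi_civita g nabla.
Hypothesis psi_cont : continuous psi.
Hypothesis psi_smooth : forall p, msmooth_at (fun q => chart (psi p) (psi q)) p.
Implicit Types (p q : M) (V W : M -> 'rV[R]_k) (u v : 'rV[R]_m).

Local Notation D := (along_nabla nabla psi).
Local Notation asmooth := (along_smooth_at psi).
Let affine := lc_affine lc.

Lemma msmooth_metric (h : riemannian N) V W p : asmooth V p -> asmooth W p ->
  msmooth_at (fun q => metric h (psi q) (V q) (W q)) p.
Proof.
move=> sV sW.
pose e b : N -> 'rV[R]_k := ext (psi p) (delta_mx 0 b).
pose f (V : M -> 'rV[R]_k) b q := coord (psi p) (psi q) (V q) 0 b.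
have sE b c : msmooth_at (fun q => metric h (psi q) (e b (psi q)) (e c (psi q))) p.
  apply: (msmooth_pull psi_cont psi_smooth (f := fun y => metric h y (e b y) (e c y))).
  by apply: gram_smooth; exact: vsmooth_ext.
have sF : msmooth_at (fun q => \sum_b \sum_c f V b q * f W c q *
    metric h (psi q) (e b (psi q)) (e c (psi q))) p.
  apply: msmooth_sum => b; apply: msmooth_sum => c; apply: msmoothM => //.
  by apply: msmoothM; exact: along_smooth_comp.
apply: msmooth_eq sF.
apply: filterS2 (along_frame psi_cont V p) (along_frame psi_cont W p) => q EV EW.
rewrite -[in RHS]EV -[in RHS]EW metric_suml; apply: eq_bigr => b _.
rewrite metric_sumr; apply: eq_bigr => c _.
by rewrite metricZl metricZr mulrA.
Qed.

Let compat p u V W := mdiff (fun q => metric g (psi q) (V q) (W q)) p u =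
  metric g (psi p) (D p u V) (W p) + metric g (psi p) (V p) (D p u W).

Let compat_sym p u V W : compat p u V W -> compat p u W V.
Proof.
rewrite /compat => E; rewrite (_ : (fun q => metric g (psi q) (W q) (V q)) =
    (fun q => metric g (psi q) (V q) (W q))).
  by rewrite E addrC !(metric_sym _ _ (D _ _ _)) (metric_sym _ _ (V p)).
by apply/funext => q; rewrite metric_sym.
Qed.

Let compat_sum p u V W : asmooth V p -> asmooth W p ->
  (forall b, compat p u (fun q => ext (psi p) (delta_mx 0 b) (psi q)) W) ->
  compat p u V W.
Proof.
move=> sV sW C; pose e b q := ext (psi p) (delta_mx 0 b : 'rV[R]_k) (psi q).
pose f b q := coord (psi p) (psi q) (V q) 0 b.
have sf b : msmooth_at (f b) p by exact: along_smooth_comp.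
have se b : asmooth (e b) p by exact: along_frame_smooth.
have sfe : asmooth (fun q => \sum_b f b q *: e b q) p.
  by apply: along_smooth_sum => b; exact: along_smoothZ.
have EV : {near p, (fun q => \sum_b f b q *: e b q) =1 V} by exact: along_frame.
have sm b : msmooth_at (fun q => metric g (psi q) (e b q) (W q)) p.
  exact: msmooth_metric.
have E : {near p, (fun q => \sum_b f b q * metric g (psi q) (e b q) (W q)) =1
    (fun q => metric g (psi q) (V q) (W q))}.
  apply: filterS EV => q <-; rewrite metric_suml.
  by apply: eq_bigr => b _; rewrite metricZl.
have sfm b := msmoothM (sf b) (sm b).
have dE := mdiff_eq u E (msmooth_sum _ sfm).
have DV := along_eq nabla u EV sfe.
have DS := along_sumZ affine (index_enum _) u sf se.
rewrite /compat dE DV DS -(nbhs_singleton EV) (mdiff_sum _ _ sfm) !metric_suml -big_split /=.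
apply: eq_bigr => b _; rewrite (mdiffM u (sf b) (sm b)).
have Cb : mdiff (fun q => metric g (psi q) (e b q) (W q)) p u =
    metric g (psi p) (D p u (e b)) (W p) + metric g (psi p) (e b p) (D p u W) := C b.
by rewrite Cb [in RHS]metricDl !metricZl; ring.
Qed.

(** The reduction to frame fields is made in one argument, then in the other by symmetry of the
    metric. For two pulled-back frame fields the identity is the pullback of [lc_metric]. *)
Lemma along_metric V W p u : asmooth V p -> asmooth W p ->
  mdiff (fun q => metric g (psi q) (V q) (W q)) p u =
  metric g (psi p) (D p u V) (W p) + metric g (psi p) (V p) (D p u W).
Proof.
move=> sV sW; apply: (compat_sum sV sW) => b; apply: compat_sym.
apply: (compat_sum sW (along_frame_smooth psi_cont psi_smooth p b)) => c.
have se (d : 'I_k) : vsmooth_at (ext (psi p) (delta_mx 0 d)) (psi p) by exact: vsmooth_ext.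
have sg : msmooth_at (fun y => metric g y (ext (psi p) (delta_mx 0 c) y)
  (ext (psi p) (delta_mx 0 b) y)) (psi p) by exact: gram_smooth.
have E := mdiff_pull psi_cont psi_smooth u sg.
have Eb := along_pull affine psi_cont psi_smooth u (se b).
have Ec := along_pull affine psi_cont psi_smooth u (se c).
by rewrite /compat E Eb Ec (lc_metric lc _ (se c) (se b)).
Qed.

(** Symmetry of the Christoffel symbols: the connection has no torsion and coordinate fields
    commute. *)
Lemma conn_ext_sym (o y : N) (w z : 'rV[R]_k) : chart_dom o y ->
  nabla y (ext o w y) (ext o z) = nabla y (ext o z y) (ext o w).
Proof.
move=> oy; apply/eqP; rewrite -subr_eq0; apply/eqP.
have := lc_torsion_free lc (vsmooth_ext_dom w oy) (vsmooth_ext_dom z oy).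
by rewrite (bracket_ext _ _ oy).
Qed.

(** The first terms of [along_nabla] agree because second derivatives of the components of [psi]
    commute, the second terms because the Christoffel symbols are symmetric. This is the source of
    the symmetry of the second fundamental form. *)
Lemma along_torsion p u v :
  D p u (fun q => dmap psi q (ext p v q)) = D p v (fun q => dmap psi q (ext p u q)).
Proof.
have sd w : msmooth_at (fun q => coord (psi p) (psi q) (dmap psi q (ext p w q))) p.
  exact: (along_smooth_dmap psi_cont psi_smooth (vsmooth_ext p w)).
have E : mdiff (fun q => coord (psi p) (psi q) (dmap psi q (ext p v q))) p u =
    mdiff (fun q => coord (psi p) (psi q) (dmap psi q (ext p u q))) p v.
  apply/rowP => b; rewrite (mdiff_rV _ _ (sd v)) (mdiff_rV _ _ (sd u)).
  have sb : msmooth_at (fun q => chart (psi p) (psi q) 0 b) p.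
    exact: ((msmooth_rVP _ _).1 (psi_smooth p) b).
  have Ew w : {near p, (fun q => mdiff (fun r => chart (psi p) (psi r) 0 b) q (ext p w q))
      =1 (fun q => coord (psi p) (psi q) (dmap psi q (ext p w q)) 0 b)}.
    apply: filterS (map_chart_near_id psi_cont p) => q pq.
    rewrite (coord_dmap psi_cont psi_smooth _ pq); apply/esym/mdiff_rV.
    exact: map_smooth.
  have sw w := msmooth_mdiff sb (vsmooth_ext p w).
  have := mdiff_sym u v (chart_dom_mem p) sb; rewrite !ext_id => S.
  have Dv := mdiff_eq u (Ew v) (sw v); have Du := mdiff_eq v (Ew u) (sw u).
  exact: etrans Dv (etrans (esym S) (esym Du)).
have S := conn_ext_sym (dmap psi p u) (dmap psi p v) (chart_dom_mem (psi p)).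
rewrite !ext_id in S.
by rewrite /along_nabla E !ext_id S.
Qed.

Lemma curv_atE (o : N) (u v w : 'rV[R]_k) : curv_at nabla o u v w =
  nabla o u (fun y => nabla y (ext o v y) (ext o w))
  - nabla o v (fun y => nabla y (ext o u y) (ext o w)).
Proof.
rewrite /curv_at /curvature (bracket_ext _ _ (chart_dom_mem o)) !ext_id.
by rewrite (conn_dir0 affine (vsmooth_ext _ _)) subr0.
Qed.

Lemma curv_at_linear3 (o : N) (a : R) (u v w z : 'rV[R]_k) :
  curv_at nabla o u v (a *: w + z) = a *: curv_at nabla o u v w + curv_at nabla o u v z.
Proof.
have s (x y : 'rV[R]_k) := vsmooth_conn_ext affine o x y.
have saz (x y : 'rV[R]_k) : vsmooth_at (fun y' => a *: nabla y' (ext o x y') (ext o y)) o.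
  exact: (@along_smoothZ _ _ _ _ _ id _ _ _ (msmooth_cst a o) (s x y)).
have E (x : 'rV[R]_k) : {near o, (fun y => a *: nabla y (ext o x y) (ext o w)
    + nabla y (ext o x y) (ext o z)) =1 (fun y => nabla y (ext o x y) (ext o (a *: w + z)))}.
  apply: filterS (chart_dom_near (chart_dom_mem o)) => y oy.
  have -> : ext o (a *: w + z) = fun y => a *: ext o w y + ext o z y.
    by apply/funext => y'; rewrite extD extZ.
  have sw := vsmooth_ext_dom w oy; have sz := vsmooth_ext_dom z oy.
  have saw : vsmooth_at (fun y => a *: ext o w y) y.
    exact: (@along_smoothZ _ _ _ _ _ id _ _ _ (msmooth_cst a y) sw).
  by rewrite (conn_add affine _ saw sz) (connZ affine _ _ sw).
have L (x t : 'rV[R]_k) : nabla o t (fun y => nabla y (ext o x y) (ext o (a *: w + z))) =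
    a *: nabla o t (fun y => nabla y (ext o x y) (ext o w))
    + nabla o t (fun y => nabla y (ext o x y) (ext o z)).
  have sD : vsmooth_at (fun y => a *: nabla y (ext o x y) (ext o w)
    + nabla y (ext o x y) (ext o z)) o.
    exact: (@along_smoothD _ _ _ _ _ id _ _ _ (saz x w) (s x z)).
  rewrite (conn_eq affine t (E x) sD) (conn_add affine t (saz x w) (s x z)).
  by rewrite (connZ affine _ _ (s x w)).
by rewrite !curv_atE !L scalerBr opprD addrACA.
Qed.

(** Differentiating [nabla] in the direction dpsi(w) also differentiates the components of dpsi(w).
    These extra terms are second derivatives of [psi], symmetric in [u] and [v], and cancel. *)
Lemma along_curvature_frame p u v b :
  D p u (fun q => D q (ext p v q) (fun r => ext (psi p) (delta_mx 0 b) (psi r)))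
  - D p v (fun q => D q (ext p u q) (fun r => ext (psi p) (delta_mx 0 b) (psi r))) =
  curv_at nabla (psi p) (dmap psi p u) (dmap psi p v) (delta_mx 0 b).
Proof.
pose e (c : 'I_k) : 'rV[R]_k := delta_mx 0 c; pose o := psi p.
pose Z c y := nabla y (ext o (e c) y) (ext o (e b)).
pose f w c q := coord (psi p) (psi q) (dmap psi q (ext p w q)) 0 c.
have sf w c : msmooth_at (f w c) p.
  apply: along_smooth_comp.
  exact: (along_smooth_dmap psi_cont psi_smooth (vsmooth_ext p w)).
have sZ c : vsmooth_at (Z c) o by exact: vsmooth_conn_ext.
have sZp c : asmooth (fun q => Z c (psi q)) p.
  exact: (along_smooth_pull psi_cont psi_smooth (sZ c)).
have E w : {near p, (fun q => \sum_c f w c q *: Z c (psi q)) =1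
    (fun q => D q (ext p w q) (fun r => ext o (e b) (psi r)))}.
  apply: filterS2 (vsmooth_ext_near psi_cont p (e b)) (conn_expand affine psi_cont p b).
  by move=> q sq Eq; rewrite (along_pull affine psi_cont psi_smooth _ sq) Eq.
have sS w : asmooth (fun q => \sum_c f w c q *: Z c (psi q)) p.
  by apply: along_smooth_sum => c; exact: along_smoothZ.
have fp w c : f w c p = dmap psi p w 0 c by rewrite /f ext_id coord_id.
have D1 w z : D p z (fun q => D q (ext p w q) (fun r => ext o (e b) (psi r))) =
    \sum_c mdiff (f w c) p z *: Z c o
    + \sum_c dmap psi p w 0 c *: nabla o (dmap psi p z) (Z c).
  rewrite (along_eq nabla z (E w) (sS w)) (along_sumZ affine _ z (sf w) sZp) big_split /=.
  congr (_ + _); apply: eq_bigr => c _; rewrite fp.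
  by rewrite (along_pull affine psi_cont psi_smooth z (sZ c)).
(* [curv_at] extends dpsi(w) with constant components, whereas [f w c] varies along M. With the
   coefficients frozen only the second sum of [D1] occurs. *)
have C w z : nabla o z (fun y => nabla y (ext o (dmap psi p w) y) (ext o (e b))) =
    \sum_c dmap psi p w 0 c *: nabla o z (Z c).
  have EC : {near o, (fun y => \sum_c dmap psi p w 0 c *: Z c y) =1
      (fun y => nabla y (ext o (dmap psi p w) y) (ext o (e b)))}.
    apply: filterS (chart_dom_near (chart_dom_mem o)) => y oy.
    have sb := vsmooth_ext_dom (e b) oy.
    rewrite (ext_sum o y (dmap psi p w)) (conn_dir_sum affine _ _ sb).
    by apply: eq_bigr => c _; rewrite (conn_dirZ affine _ _ sb).
  have sc c : vsmooth_at (fun y => dmap psi p w 0 c *: Z c y) o.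
    exact: (@along_smoothZ _ _ _ _ _ id _ _ _ (msmooth_cst _ o) (sZ c)).
  have sC : vsmooth_at (fun y => \sum_c dmap psi p w 0 c *: Z c y) o.
    exact: (@along_smooth_sum _ _ _ _ _ id _ _ _ _ sc).
  rewrite (conn_eq affine z EC sC) (conn_sum affine _ _ sc).
  by apply: eq_bigr => c _; rewrite (connZ affine _ _ (sZ c)).
have S c : mdiff (f v c) p u = mdiff (f u c) p v.
  have sc : msmooth_at (fun q => chart (psi p) (psi q) 0 c) p.
    exact: ((msmooth_rVP _ _).1 (psi_smooth p) c).
  have Ef w : {near p, (fun q => mdiff (fun r => chart (psi p) (psi r) 0 c) q (ext p w q))
      =1 f w c}.
    apply: filterS (map_chart_near_id psi_cont p) => q pq.
    rewrite /f (coord_dmap psi_cont psi_smooth _ pq); apply/esym/mdiff_rV.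
    exact: map_smooth.
  have sw w := msmooth_mdiff sc (vsmooth_ext p w).
  have := mdiff_sym u v (chart_dom_mem p) sc; rewrite !ext_id => S.
  have Dv := mdiff_eq u (Ef v) (sw v); have Du := mdiff_eq v (Ef u) (sw u).
  exact: etrans Dv (etrans (esym S) (esym Du)).
rewrite curv_atE !C [X in X - _]D1 [X in _ - X]D1.
have -> : \sum_c mdiff (f v c) p u *: Z c o = \sum_c mdiff (f u c) p v *: Z c o.
  by apply: eq_bigr => c _; rewrite S.
by rewrite opprD addrACA subrr add0r.
Qed.

Lemma curv_at_sum3 (o : N) (u v w : 'rV[R]_k) :
  curv_at nabla o u v w = \sum_b w 0 b *: curv_at nabla o u v (delta_mx 0 b).
Proof.
have C0 : curv_at nabla o u v 0 = 0.
  by have := curv_at_linear3 o (-1) u v 0 0; rewrite scaler0 addr0 scaleN1r addNr.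
have Z a x : curv_at nabla o u v (a *: x) = a *: curv_at nabla o u v x.
  by rewrite -[a *: x]addr0 curv_at_linear3 C0 addr0.
have A x y : curv_at nabla o u v (x + y) = curv_at nabla o u v x + curv_at nabla o u v y.
  by rewrite -[x]scale1r curv_at_linear3 !scale1r.
by rewrite {1}(row_sum_delta w) (big_morph _ A C0); apply: eq_bigr => b _; rewrite Z.
Qed.

(** In the frame expansion of [W] the second derivatives of the coefficients commute and the terms
    with one derivative on each factor are symmetric. Only the coefficients times the curvature of
    the frame fields survive. *)
Lemma along_curvature W p u v : asmooth W p ->
  D p u (fun q => D q (ext p v q) W) - D p v (fun q => D q (ext p u q) W) =
  curv_at nabla (psi p) (dmap psi p u) (dmap psi p v) (W p).
Proof.
move=> sW; pose e b q := ext (psi p) (delta_mx 0 b : 'rV[R]_k) (psi q).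
pose f b q := coord (psi p) (psi q) (W q) 0 b.
have sf b : msmooth_at (f b) p by exact: along_smooth_comp.
have se b : asmooth (e b) p by exact: along_frame_smooth.
have sx w : vsmooth_at (ext p w) p by exact: vsmooth_ext.
have sDe w b : asmooth (fun q => D q (ext p w q) (e b)) p.
  exact: (along_smooth_nabla affine psi_cont psi_smooth (sx w) (se b)).
have sdf w b : msmooth_at (fun q => mdiff (f b) q (ext p w q)) p by exact: msmooth_mdiff.
have E w : {near p, (fun q => \sum_b (mdiff (f b) q (ext p w q) *: e b q
    + f b q *: D q (ext p w q) (e b))) =1 (fun q => D q (ext p w q) W)}.
  have H : \forall q \near p, forall b, vsmooth_at (ext (psi p) (delta_mx 0 b)) (psi q).
    by apply: filter_forall => b; exact: vsmooth_ext_near.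
  apply: filterS2 (along_expand affine psi_cont psi_smooth sW) H => q Eq sq.
  rewrite Eq; apply: eq_bigr => b _.
  by rewrite (along_pull affine psi_cont psi_smooth _ (sq b)).
have s1 w b := along_smoothZ (sdf w b) (se b).
have s2 w b := along_smoothZ (sf b) (sDe w b).
have s12 w b := along_smoothD (s1 w b) (s2 w b).
have D1 w z : D p z (fun q => D q (ext p w q) W) =
    \sum_b (mdiff (fun q => mdiff (f b) q (ext p w q)) p z *: e b p
       + (mdiff (f b) p w *: D p z (e b) + mdiff (f b) p z *: D p w (e b)))
    + \sum_b f b p *: D p z (fun q => D q (ext p w q) (e b)).
  rewrite (along_eq nabla z (E w) (along_smooth_sum (index_enum _) (s12 w))).
  rewrite (along_sum affine _ z (s12 w)) -big_split; apply: eq_bigr => b _ /=.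
  rewrite (alongD affine z (s1 w b) (s2 w b)).
  rewrite (alongZ affine z (sdf w b) (se b)) (alongZ affine z (sf b) (sDe w b)) !ext_id.
  by rewrite !addrA.
rewrite [X in X - _]D1 [X in _ - X]D1 opprD addrACA -sumrB big1 ?add0r.
  rewrite curv_at_sum3 -sumrB; apply: eq_bigr => b _.
  by rewrite -scalerBr -along_curvature_frame /f coord_id.
move=> b _; have := mdiff_sym u v (chart_dom_mem p) (sf b); rewrite !ext_id => ->.
by apply/eqP; rewrite subr_eq0; apply/eqP; congr (_ + _); exact: addrC.
Qed.

End AlongLeviCivita.

(** * Curvature identities *)

Section Curvature.
Variables (R : realType) (k : nat) (N : manifold R k) (g : riemannian N).
Variable nabla : connection N.
Hypothesis lc : is_levi_civita g nabla.
Implicit Types (o : N) (u v w z : 'rV[R]_k).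
Let affine := lc_affine lc.

Local Notation curv := (curv_at nabla).

Lemma curv_skew12 o u v w : curv o u v w = - curv o v u w.
Proof. by rewrite !(curv_atE lc) opprB. Qed.

(** For coordinate fields the two inner arguments of each second derivative may be exchanged, after
    which the six terms cancel in pairs. *)
Lemma curv_bianchi o u v w : curv o u v w + curv o v w u + curv o w u v = 0.
Proof.
have E x y z : nabla o x (fun q => nabla q (ext o y q) (ext o z)) =
    nabla o x (fun q => nabla q (ext o z q) (ext o y)).
  apply: (conn_eq affine); last exact: vsmooth_conn_ext.
  apply: filterS (chart_dom_near (chart_dom_mem o)) => q oq.
  exact: (conn_ext_sym lc).
rewrite !(curv_atE lc) (E u w v) (E v w u) (E w v u).
set a := nabla o u _; set b := nabla o v _; set c := nabla o w _.
by apply/rowP => i; rewrite !mxE; ring.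
Qed.

(** Differentiating the function |w|^2 twice gives, after antisymmetrization in [u] and [v], twice
    the left-hand side, while Schwarz's theorem gives zero. *)
Lemma curv_skew34_diag o u v w : metric g o (curv o u v w) w = 0.
Proof.
pose e x := ext o x; have se x : vsmooth_at (e x) o by exact: vsmooth_ext.
have sn x : vsmooth_at (fun q => nabla q (e x q) (e w)) o by exact: vsmooth_conn_ext.
have sg : msmooth_at (fun q => metric g q (e w q) (e w q)) o by exact: gram_smooth.
pose A x q := metric g q (nabla q (e x q) (e w)) (e w q).
have sA x : msmooth_at (A x) o by exact: (gram_smooth g (sn x) (se w)).
have E x : {near o, (fun q => A x q + A x q) =1
    (fun q => mdiff (fun q => metric g q (e w q) (e w q)) q (e x q))}.
  apply: filterS (chart_dom_near (chart_dom_mem o)) => q oq.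
  have sw := vsmooth_ext_dom w oq.
  by rewrite (lc_metric lc _ sw sw) [X in _ = _ + X]metric_sym.
have DA x y : mdiff (A x) o y = metric g o (nabla o y (fun q => nabla q (e x q) (e w))) w
    + metric g o (nabla o x (e w)) (nabla o y (e w)).
  by rewrite (lc_metric lc y (sn x) (se w)) /e !ext_id.
have DD x y : mdiff (fun q => mdiff (fun q => metric g q (e w q) (e w q)) q (e x q)) o y =
    mdiff (A x) o y + mdiff (A x) o y.
  by rewrite (mdiff_eq y (E x) (msmoothD (sA x) (sA x))) (mdiffD y (sA x) (sA x)).
have := mdiff_sym u v (chart_dom_mem o) sg; rewrite !ext_id => S.
have := etrans (esym (DD u v)) (etrans S (DD v u)).
rewrite !DA (curv_atE lc) metricBl (metric_sym g o (nabla o v (e w))) /e.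
by move=> H; lra.
Qed.

Lemma curv_skew34 o u v w z : metric g o (curv o u v w) z = - metric g o (curv o u v z) w.
Proof.
have := curv_skew34_diag o u v (w + z); rewrite -{1}[w]scale1r (curv_at_linear3 lc) scale1r.
rewrite (metricDl g o (curv o u v w) (curv o u v z)) !(metricDr g o w z).
by rewrite !curv_skew34_diag; lra.
Qed.

Lemma curv_pair_sym o u v w z :
  metric g o (curv o u v w) z = metric g o (curv o w z u) v.
Proof.
have B x y s t : metric g o (curv o x y s) t + metric g o (curv o y s x) t
    + metric g o (curv o s x y) t = 0.
  by rewrite -(metricDl g o (curv o x y s)) -metricDl curv_bianchi metric0l.
have S12 x y s t : metric g o (curv o x y s) t = - metric g o (curv o y x s) t.
  by rewrite curv_skew12 metricNl.
have S34 := curv_skew34 o.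
(* The classical octahedron argument: four Bianchi identities and the two skew symmetries form a
   linear system that contains the claim. *)
have := (B u v w z, B v w z u, B w z u v, B z u v w).
have := (S34 v w z u, S34 w z v u, S12 z v w u, S34 v z w u, S34 z u w v).
have := (S12 u w z v, S34 w u z v, S34 u v z w).
move=> [[? ?] ?] [[[[? ?] ?] ?] ?] [[[? ?] ?] ?]; lra.
Qed.

End Curvature.

(** * Closed conformal fields: conformal factor and curvature *)

Section ClosedConformal.
Variables (R : realType) (n : nat) (N : manifold R n.+1) (g : riemannian N).
Variable nabla : connection N.
Hypothesis lc : is_levi_civita g nabla.
Variables (X : N -> 'rV[R]_n.+1) (f : N -> R).
Hypothesis sX : forall p, vsmooth_at X p.
Hypothesis Xf : forall p v, nabla p v X = f p *: v.
Let affine := lc_affine lc.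

(** The derivative of [X] is [f p] times the identity, of trace n + 1 times [f p]. The dimension is
    a successor, so the division is harmless. *)
Lemma conformal_factorE p : conformal_factor nabla X p = f p.
Proof.
rewrite /conformal_factor /divergence (_ : \matrix_(i, j) _ = (f p)%:M).
  by rewrite mxtrace_scalar -[f p *+ _]mulr_natl mulKf // pnatr_eq0.
by apply/matrixP => i j; rewrite !mxE Xf !mxE eqxx mulr_natr eq_sym.
Qed.

(** Closed conformality provides [f] only as a function. Its smoothness is read off component 0 of
    the derivative of [X] along coordinate field 0. *)
Lemma conformal_factor_smooth p : msmooth_at f p.
Proof.
have sE := vsmooth_ext p (delta_mx 0 0 : 'rV[R]_n.+1).
have := (msmooth_rVP _ _).1 (conn_smooth affine sE (sX p)) 0.
apply: msmooth_eq; apply: filterS (chart_dom_near (chart_dom_mem p)) => q pq.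
by rewrite Xf coordZ extE // !mxE !eqxx mulr1.
Qed.

Lemma conformal_curvature p u v : curv_at nabla p u v (X p) = mdiff f p u *: v - mdiff f p v *: u.
Proof.
have idc : continuous (fun q : N => q) by move=> ?; exact: cvg_id.
(* Applied to the identity map, the formula admits the field [X] itself in the third slot, where
   [curv_at] would use the extension of [X p] with constant components. *)
have H := along_curvature lc idc (@id_smooth _ _ N) u v (sX p).
rewrite !dmap_id in H; rewrite -H.
have sf := conformal_factor_smooth p.
have E w : (fun q => along_nabla nabla (fun q : N => q) q (ext p w q) X) =
    (fun q => f q *: ext p w q).
  apply/funext => q; have := along_pull affine idc (@id_smooth _ _ N) (ext p w q) (sX q).
  by rewrite dmap_id Xf.
have sx w := vsmooth_ext p w.
have DE w z : along_nabla nabla (fun q : N => q) p z (fun q => f q *: ext p w q) =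
    mdiff f p z *: w + f p *: nabla p z (ext p w).
  rewrite (alongZ affine z sf (sx w)) ext_id.
  by have := along_pull affine idc (@id_smooth _ _ N) z (sx w); rewrite dmap_id => ->.
have S := conn_ext_sym lc u v (chart_dom_mem p); rewrite !ext_id in S.
by rewrite !E !DE S opprD addrACA subrr addr0.
Qed.

End ClosedConformal.

(** * The Gauss formula *)

Section Gauss.
Variables (R : realType) (m k : nat) (M : manifold R m) (N : manifold R k).
Variables (g : riemannian M) (gN : riemannian N).
Variables (nabla : connection M) (nablaN : connection N) (psi : M -> N).
Hypothesis lc : is_levi_civita g nabla.
Hypothesis lcN : is_levi_civita gN nablaN.
Hypothesis psi_cont : continuous psi.
Hypothesis psi_smooth : forall p, msmooth_at (fun q => chart (psi p) (psi q)) p.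
Hypothesis psi_isom : forall p u v,
  metric gN (psi p) (dmap psi p u) (dmap psi p v) = metric g p u v.

Local Notation D := (along_nabla nablaN psi).

(** The uniqueness argument for the Levi-Civita connection: the difference [S] is symmetric in its
    first two arguments by torsion-freeness and skew in the last two by compatibility with the
    isometric metrics, hence zero. *)
Lemma gauss_ext p u v w :
  metric gN (psi p) (D p u (fun q => dmap psi q (ext p v q))) (dmap psi p w) =
  metric g p (nabla p u (ext p v)) w.
Proof.
pose S a b c := metric gN (psi p) (D p a (fun q => dmap psi q (ext p b q))) (dmap psi p c)
  - metric g p (nabla p a (ext p b)) c.
have S12 a b c : S a b c = S b a c.
  rewrite /S (along_torsion lcN psi_cont psi_smooth).
  by have := conn_ext_sym lc a b (chart_dom_mem p); rewrite !ext_id => ->.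
have S23 a b c : S a b c + S a c b = 0.
  have sb := vsmooth_ext p b; have sc := vsmooth_ext p c.
  have sdb := along_smooth_dmap psi_cont psi_smooth sb.
  have sdc := along_smooth_dmap psi_cont psi_smooth sc.
  have := along_metric lcN psi_cont psi_smooth a sdb sdc.
  rewrite (_ : (fun q => _) = (fun q => metric g q (ext p b q) (ext p c q))); last first.
    by apply/funext => q; exact: psi_isom.
  rewrite (lc_metric lc a sb sc) !ext_id.
  rewrite (metric_sym gN _ (dmap psi p b)) (metric_sym g _ b) /S.
  by move=> E; lra.
apply/eqP; rewrite -subr_eq0; apply/eqP; rewrite -/(S u v w).
have := (S12 u v w, S12 v w u, S12 w u v, S23 u v w, S23 v w u, S23 w u v).
by move=> [[[[[? ?] ?] ?] ?] ?]; lra.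
Qed.

(** Both sides obey the same Leibniz rule, and the isometry matches the terms in which the
    coefficients are differentiated. *)
Lemma gauss p u V w : vsmooth_at V p ->
  metric gN (psi p) (D p u (fun q => dmap psi q (V q))) (dmap psi p w) =
  metric g p (nabla p u V) w.
Proof.
move=> sV; pose f b q := coord p q (V q) 0 b; pose e b := ext p (delta_mx 0 b : 'rV[R]_m).
have affine := lc_affine lc; have affineN := lc_affine lcN.
have sf b : msmooth_at (f b) p by exact: ((msmooth_rVP _ _).1 sV b).
have se b : vsmooth_at (e b) p by exact: vsmooth_ext.
have sde b := along_smooth_dmap psi_cont psi_smooth (se b).
have E : {near p, (fun q => \sum_b f b q *: e b q) =1 V}.
  apply: filterS (chart_dom_near (chart_dom_mem p)) => q pq.
  by rewrite -ext_sum coordK.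
have sfe b : vsmooth_at (fun q => f b q *: e b q) p.
  exact: (@along_smoothZ _ _ _ _ _ id _ _ _ (sf b) (se b)).
have sfde b := along_smoothZ (sf b) (sde b).
have DE : {near p, (fun q => \sum_b f b q *: dmap psi q (e b q)) =1
    (fun q => dmap psi q (V q))}.
  by apply: filterS E => q <-; rewrite dmap_sum; apply: eq_bigr => b _; rewrite dmapZ.
rewrite (along_eq nablaN u DE (along_smooth_sum (index_enum _) sfde)).
rewrite (conn_eq affine u E); last exact: (@along_smooth_sum _ _ _ _ _ id _ _ _ _ sfe).
rewrite (along_sum affineN _ u sfde) (conn_sum affine _ u sfe) !metric_suml.
apply: eq_bigr => b _; rewrite (alongZ affineN u (sf b) (sde b)).
rewrite (conn_leibniz affine u (sf b) (se b)) !metricDl !metricZl psi_isom.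
by rewrite gauss_ext.
Qed.

End Gauss.

(** * Frames and traces *)

Section SmoothMatrices.
Variables (R : realType) (n : nat) (M : manifold R n).
Implicit Types p q : M.

Lemma msmooth_prod (I : Type) (s : seq I) (f : I -> M -> R) p :
  (forall i, msmooth_at (f i) p) -> msmooth_at (fun q => \prod_(i <- s) f i q) p.
Proof.
move=> sf; elim: s => [|i s IH].
  by under eq_fun do rewrite big_nil; exact: msmooth_cst.
by under eq_fun do rewrite big_cons; exact: msmoothM.
Qed.

Lemma msmooth_det l (A : M -> 'M[R]_l) p :
  (forall i j, msmooth_at (fun q => A q i j) p) -> msmooth_at (fun q => \det (A q)) p.
Proof.
move=> sA; rewrite /determinant; apply: msmooth_sum => s; apply: msmoothM.
  exact: msmooth_cst.
by apply: msmooth_prod => i.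
Qed.

Lemma msmooth_adj l (A : M -> 'M[R]_l) p i j :
  (forall i j, msmooth_at (fun q => A q i j) p) -> msmooth_at (fun q => (\adj (A q)) i j) p.
Proof.
move=> sA; under eq_fun do rewrite mxE /cofactor.
apply: msmoothM; first exact: msmooth_cst.
apply: msmooth_det => a b; under eq_fun do rewrite !mxE; exact: sA.
Qed.

Lemma msmooth_continuous (f : M -> R) p : msmooth_at f p -> {for p, continuous f}.
Proof.
move=> sf; have pp := chart_dom_mem p.
have fc := differentiable_continuous (msmooth_diff sf).
have E : {near p, (f \o chart_inv p) \o chart p =1 f}.
  by apply: filterS (chart_dom_near pp) => q pq /=; rewrite chartK.
have H : ((f \o chart_inv p) \o chart p) q @[q --> p] --> f p.
  rewrite -[X in _ --> f X](chartK pp).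
  by apply: (@continuous_comp _ _ _ (chart p) (f \o chart_inv p) p (chart_cont pp) fc).
apply: cvg_trans H; apply: near_eq_cvg.
exact: E.
Qed.

Lemma msmooth_neq0 (f : M -> R) p : msmooth_at f p -> f p != 0 -> \forall q \near p, f q != 0.
Proof.
move=> /msmooth_continuous fc f0; apply: (fc [set r | r != 0]).
by apply: open_nbhs_nbhs; split => //; exact: open_neq.
Qed.

Lemma msmooth_invmx l (A : M -> 'M[R]_l) p i j : A p \in unitmx ->
  (forall i j, msmooth_at (fun q => A q i j) p) -> msmooth_at (fun q => (invmx (A q)) i j) p.
Proof.
move=> uA sA; have sd := msmooth_det sA.
have d0 : \det (A p) != 0 by rewrite -unitfE -unitmxE.
have := msmoothM (msmoothV sd d0) (msmooth_adj i j sA).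
(* Cramer's rule. Where the determinant vanishes [invmx] returns its argument, so the formula is
   claimed only near [p]. *)
apply: msmooth_eq; apply: filterS (msmooth_neq0 sd d0) => q dq.
by rewrite /invmx unitmxE unitfE dq [RHS]mxE.
Qed.

End SmoothMatrices.

(** * Traces in a pair of dual frames *)

Section Biorthogonal.
Variables (R : realType) (n : nat) (M : manifold R n) (g : riemannian M) (p : M).
Variables (F F' : 'I_n -> 'rV[R]_n).
Hypothesis FF' : forall i j, metric g p (F i) (F' j) = (i == j)%:R.

Let P : 'M[R]_n := \matrix_i F i.
Let Q : 'M[R]_n := \matrix_i F' i.

Lemma metric_mx l (u : 'I_n -> 'rV[R]_n) (A : 'M[R]_(l, n)) i j :
  (A *m g p *m (\matrix_a u a)^T) i j = metric g p (row i A) (u j).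
Proof.
rewrite /metric !mxE; apply: eq_bigr => a _; rewrite !mxE; congr (_ * _).
by apply: eq_bigr => b _; rewrite !mxE.
Qed.

Let PgQ : P *m g p *m Q^T = 1%:M.
Proof. by apply/matrixP => i j; rewrite metric_mx rowK FF' mxE. Qed.

Let gQP : g p *m Q^T *m P = 1%:M.
Proof. by apply: mulmx1C; rewrite mulmxA. Qed.

Lemma biorthogonal_expand v : v = \sum_i metric g p v (F' i) *: F i.
Proof.
rewrite -[LHS]mulmx1 -gQP !mulmxA mulmx_sum_row; apply: eq_bigr => i _.
by rewrite rowK -{2}(row_id 0 v); congr (_ *: _); exact: metric_mx.
Qed.

(** Duality of the frames makes the inverse Gram matrix equal to [Q^T *m P]. Taking both frames
    equal covers the orthonormal case. *)
Lemma mtrace_biorthogonal (V : lmodType R) (B : 'rV[R]_n -> 'rV[R]_n -> V) :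
  (forall a u v w, B (a *: u + v) w = a *: B u w + B v w) ->
  (forall a u v w, B w (a *: u + v) = a *: B w u + B w v) ->
  mtrace g p B = \sum_i B (F' i) (F i).
Proof.
move=> Bl Br.
have GV : invmx (g p) = Q^T *m P.
  by rewrite -[RHS](mulKmx (gram_unit g p)) (mulmxA (g p)) gQP mulmx1.
have B0l w : B 0 w = 0.
  by have := Bl (-1) 0 0 w; rewrite scaler0 addr0 scaleN1r addNr.
have B0r w : B w 0 = 0.
  by have := Br (-1) 0 0 w; rewrite scaler0 addr0 scaleN1r addNr.
have sl w (a : 'I_n -> R) (x : 'I_n -> 'rV[R]_n) :
    B (\sum_i a i *: x i) w = \sum_i a i *: B (x i) w.
  elim: (index_enum _) => [|i r IH]; first by rewrite !big_nil.
  by rewrite !big_cons Bl IH.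
have sr w (a : 'I_n -> R) (x : 'I_n -> 'rV[R]_n) :
    B w (\sum_i a i *: x i) = \sum_i a i *: B w (x i).
  elim: (index_enum _) => [|i r IH]; first by rewrite !big_nil.
  by rewrite !big_cons Br IH.
have E i : B (F' i) (F i) =
    \sum_a \sum_b (Q i a * P i b) *: B (delta_mx 0 a) (delta_mx 0 b).
  rewrite {1}(row_sum_delta (F' i)) sl; apply: eq_bigr => a _.
  rewrite (row_sum_delta (F i)) sr scaler_sumr; apply: eq_bigr => b _.
  by rewrite scalerA !mxE.
rewrite /mtrace GV; under [RHS]eq_bigr do rewrite E.
rewrite [RHS]exchange_big /=; apply: eq_bigr => a _.
rewrite [RHS]exchange_big /=; apply: eq_bigr => b _.
rewrite -scaler_suml; congr (_ *: _); rewrite mxE.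
by apply: eq_bigr => i _; rewrite mxE.
Qed.

(** Vectors are rows, so [L] is right multiplication by its matrix; inserting [g p *m Q^T *m P = 1]
    and rotating the trace gives the sum. *)
Lemma trace_biorthogonal (L : 'rV[R]_n -> 'rV[R]_n) :
  (forall a u v, L (a *: u + v) = a *: L u + L v) ->
  \tr (\matrix_(i, j) L (delta_mx 0 i) 0 j) = \sum_i metric g p (L (F i)) (F' i).
Proof.
move=> Ll; set A := \matrix_(i, j) _.
have L0 : L 0 = 0 by have := Ll (-1) 0 0; rewrite scaler0 addr0 scaleN1r addNr.
have LE v : L v = v *m A.
  rewrite mulmx_sum_row [in LHS](row_sum_delta v).
  elim: (index_enum _) => [|i r IH]; first by rewrite !big_nil.
  rewrite !big_cons Ll IH; congr (_ *: _ + _).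
  by apply/rowP => j; rewrite !mxE.
rewrite -[A]mulmx1 -gQP mulmxA mxtrace_mulC !mulmxA; apply: eq_bigr => i _.
by rewrite LE -[F i](rowK F) -row_mul; exact: metric_mx.
Qed.

End Biorthogonal.

(** * Smoothness of dual vectors and gradients *)

Section Sharp.
Variables (R : realType) (n : nat) (M : manifold R n) (g : riemannian M).
Implicit Types p q : M.

Lemma gram_ext_unit p q : chart_dom p q ->
  \matrix_(a, b) metric g q (ext p (delta_mx 0 a) q) (ext p (delta_mx 0 b) q) \in unitmx.
Proof.
move=> pq; rewrite -row_free_unit -kermx_eq0; apply/eqP/row_matrixP => i.
rewrite row0; set G := \matrix_(a, b) _; set x := row i _.
have xG : x *m G = 0 by rewrite -row_mul mulmx_ker row0.
have x0 : ext p x q = 0.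
  apply: (@metric_nondeg _ _ _ g q) => v.
  rewrite -(coordK v pq) !(ext_sum p q x) (ext_sum p q (coord p q v)) metric_sumr big1 //.
  move=> b _; rewrite metricZr metric_suml.
  have xGb : (x *m G) 0 b = 0 by rewrite xG mxE.
  suff -> : \sum_a metric g q (x 0 a *: ext p (delta_mx 0 a) q)
      (ext p (delta_mx 0 b) q) = (x *m G) 0 b by rewrite xGb mulr0.
  by rewrite [RHS]mxE; apply: eq_bigr => a _; rewrite metricZl; congr (_ * _); rewrite [RHS]mxE.
by rewrite -(extE x pq) x0 /coord linear0.
Qed.

Lemma sharp_smooth (al : M -> 'rV[R]_n -> R) p :
  (forall q b u w, al q (b *: u + w) = b * al q u + al q w) ->
  (forall v, msmooth_at (fun q => al q (ext p v q)) p) ->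
  vsmooth_at (fun q => sharp g q (al q)) p.
Proof.
move=> all sal; pose e b := ext p (delta_mx 0 b : 'rV[R]_n).
pose G q := \matrix_(a, b) metric g q (e a q) (e b q).
(* [sharp] at [q] uses the Gram matrix in the chart at [q], which changes with [q]. The row [s q]
   solves the same duality equations in the frame of the chart at [p], where all entries are
   smooth. *)
pose s q := \row_b (al q (e b q)) *m invmx (G q).
have E : {near p, s =1 fun q => coord p q (sharp g q (al q))}.
  apply: filterS (chart_dom_near (chart_dom_mem p)) => q pq.
  have uG : G q \in unitmx := gram_ext_unit pq.
  suff <- : ext p (s q) q = sharp g q (al q) by rewrite extE.
  apply/eqP; rewrite -subr_eq0; apply/eqP/(@metric_nondeg _ _ _ g q) => v.
  apply/eqP; rewrite metricBl subr_eq0; apply/eqP.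
  rewrite -(coordK v pq) (ext_sum p q (coord p q v)) !metric_sumr.
  apply: eq_bigr => b _; rewrite !metricZr; congr (_ * _).
  rewrite (metric_sharp g q _ (all q)) (ext_sum p q (s q)) metric_suml.
  have <- : (s q *m G q) 0 b = al q (e b q) by rewrite mulmxKV // mxE.
  by rewrite mxE; apply: eq_bigr => a _; rewrite metricZl; congr (_ * _); rewrite mxE.
apply: msmooth_eq E _; apply/msmooth_rVP => b; under eq_fun do rewrite mxE.
apply: msmooth_sum => a; apply: msmoothM.
  by under eq_fun do rewrite mxE; exact: sal.
apply: msmooth_invmx; first exact: (gram_ext_unit (chart_dom_mem p)).
move=> i j; under eq_fun do rewrite mxE.
by apply: gram_smooth; exact: vsmooth_ext.
Qed.

Lemma grad_smooth (f : M -> R) p : msmooth_at f p -> vsmooth_at (grad g f) p.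
Proof.
move=> sf; apply: sharp_smooth => [q b u w|v]; first by rewrite mdiffDv mdiffZv.
by apply: msmooth_mdiff => //; exact: vsmooth_ext.
Qed.

Lemma metric_grad (f : M -> R) q v : metric g q (grad g f q) v = mdiff f q v.
Proof. by rewrite metric_sharp // => b u w; rewrite mdiffDv mdiffZv. Qed.

End Sharp.

(** * Frames parallel at a point *)

Section Frames.
Variables (R : realType) (n : nat) (M : manifold R n) (g : riemannian M).
Variable nabla : connection M.
Hypothesis lc : is_levi_civita g nabla.
Implicit Types p q : M.
Let affine := lc_affine lc.

Lemma parallel_extension p v : exists V, [/\ vsmooth_at V p, V p = v &
  forall u, nabla p u V = 0].
Proof.
pose w a := nabla p (delta_mx 0 a) (ext p v).
(* A function with value 0 and differential [- u 0 a] at [p]. Multiplying [w a] by it cancels the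
   derivative of [ext p v] in coordinate direction [a] without changing the value at [p]. *)
pose x a q := chart p p 0 a - chart p q 0 a.
have sx a : msmooth_at (x a) p.
  have sc : msmooth_at (fun q => chart p q 0 a) p.
    exact: ((msmooth_rVP _ _).1 (id_smooth p) a).
  have := msmoothD (msmooth_cst (chart p p 0 a) p) (msmoothM (msmooth_cst (-1 : R) p) sc).
  by apply: msmooth_eq; apply: nearW => q; rewrite mulN1r.
have dx a u : mdiff (x a) p u = - u 0 a.
  have sc : msmooth_at (fun q => chart p q 0 a) p.
    exact: ((msmooth_rVP _ _).1 (id_smooth p) a).
  have -> : x a = fun q => chart p p 0 a + (-1) * chart p q 0 a.
    by apply/funext => q; rewrite mulN1r.
  have s1 := msmooth_cst (chart p p 0 a) p; have s2 := msmooth_cst (-1 : R) p.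
  rewrite (mdiffD u s1 (msmoothM s2 sc)) (mdiffM u s2 sc) !mdiff_cst mulr0 addr0 add0r mulN1r.
  rewrite -(mdiff_rV u a (id_smooth p)); congr (- _).
  have E : mdiff (fun q => chart p q) p u = u := coord_id p u.
  by rewrite E.
have sw a := along_smoothZ (psi := id) (sx a) (vsmooth_ext p (w a)).
have sS := @along_smooth_sum _ _ _ _ _ id _ (index_enum _) _ _ sw.
have sv := vsmooth_ext p v.
exists (fun q => ext p v q + \sum_a x a q *: ext p (w a) q); split.
- exact: (@along_smoothD _ _ _ _ _ id _ _ _ sv sS).
- rewrite ext_id big1 ?addr0 // => a _; by rewrite /x subrr scale0r.
move=> u; rewrite (conn_add affine u sv sS) (conn_sum affine _ u sw).
rewrite {1}(row_sum_delta u) (conn_dir_sum affine _ _ sv) -big_split big1 //= => a _.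
rewrite (conn_dirZ affine _ _ sv) (conn_leibniz affine u (sx a) (vsmooth_ext p (w a))).
by rewrite dx ext_id /x subrr scale0r addr0 scaleNr addrN.
Qed.

(** [F'] is obtained from [F] by the inverse of its Gram matrix, a smooth operation without square
    roots, and it coincides with [F] at [p], where that matrix is the identity. *)
Lemma reciprocal_frame p (e : 'I_n -> 'rV[R]_n) : orthonormal_frame g p e ->
  exists F F' : 'I_n -> M -> 'rV[R]_n,
  [/\ forall i, [/\ vsmooth_at (F i) p, F i p = e i & forall u, nabla p u (F i) = 0],
      forall i, [/\ vsmooth_at (F' i) p, F' i p = e i & forall u, nabla p u (F' i) = 0] &
      \forall q \near p, forall i j, metric g q (F i q) (F' j q) = (i == j)%:R].
Proof.
move=> oe; have /choice[F FP] := fun i => parallel_extension p (e i).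
pose G q := \matrix_(i, j) metric g q (F i q) (F j q).
have sF i : vsmooth_at (F i) p by have [] := FP i.
have Fp i : F i p = e i by have [] := FP i.
have sg i j : msmooth_at (fun q => metric g q (F i q) (F j q)) p by exact: gram_smooth.
have sG i j : msmooth_at (fun q => G q i j) p by under eq_fun do rewrite mxE; exact: sg.
have Gp : G p = 1%:M by apply/matrixP => i j; rewrite !mxE !Fp oe.
have uG : G p \in unitmx by rewrite Gp unitmx1.
have sI i j := msmooth_invmx i j uG sG.
pose F' j q := \sum_i invmx (G q) i j *: F i q.
have sF' j : vsmooth_at (F' j) p.
  have s i := along_smoothZ (psi := id) (sI i j) (sF i).
  exact: (@along_smooth_sum _ _ _ _ _ id _ _ _ _ s).
have F'p j : F' j p = e j.
  rewrite /F' Gp invmx1 (bigD1 j) //= mxE eqxx scale1r Fp big1 ?addr0 // => i ij.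
  by rewrite mxE (negbTE ij) scale0r.
have dual : \forall q \near p, forall i j, metric g q (F i q) (F' j q) = (i == j)%:R.
  have sd := msmooth_det sG; have d0 : \det (G p) != 0 by rewrite Gp det1 oner_neq0.
  apply: filterS (msmooth_neq0 sd d0) => q dq i j.
  have uq : G q \in unitmx by rewrite unitmxE unitfE.
  have := congr1 (fun A : 'M[R]_n => A i j) (mulmxV uq); rewrite !mxE => <-.
  rewrite metric_sumr; apply: eq_bigr => l _.
  by rewrite metricZr mulrC; congr (_ * _); rewrite mxE.
exists F, F'; split=> // j; split=> // u.
(* The products [<F_i, F'_j>] are constant near [p] and [F i] is parallel at [p], so the derivative
   of [F' j] is orthogonal to every [e i]. *)
have e0 i : metric g p (nabla p u (F' j)) (e i) = 0.
  have [_ _ F0] := FP i.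
  have E : {near p, (fun _ => (i == j)%:R) =1 fun q => metric g q (F i q) (F' j q)}.
    by apply: filterS dual => q ->.
  have := mdiff_eq u E (msmooth_cst _ p).
  rewrite (lc_metric lc u (sF i) (sF' j)) F0 metric0l add0r Fp mdiff_cst.
  by rewrite metric_sym.
rewrite (biorthogonal_expand oe (nabla p u (F' j))) big1 // => i _.
by rewrite e0 scale0r.
Qed.

(** Since [F i] is parallel at [p], differentiating [<grad f, F_i>] along [e i] leaves only the
    Hessian term, and these terms sum to the divergence. *)
Lemma laplacian_frame (f : M -> R) p (e : 'I_n -> 'rV[R]_n) (F : 'I_n -> M -> 'rV[R]_n) :
  orthonormal_frame g p e -> msmooth_at f p ->
  (forall i, [/\ vsmooth_at (F i) p, F i p = e i & forall u, nabla p u (F i) = 0]) ->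
  laplacian nabla g f p = \sum_i mdiff (fun q => mdiff f q (F i q)) p (e i).
Proof.
move=> oe sf FP; have sg := grad_smooth g sf.
rewrite /laplacian /divergence.
rewrite (trace_biorthogonal oe (L := fun v => nabla p v (grad g f))); last first.
  by move=> a u v; exact: (conn_linear affine sg).
apply: eq_bigr => i _; have [sF Fp F0] := FP i.
have := lc_metric lc (e i) sg sF; rewrite F0 metric0r addr0 Fp => <-.
by congr (mdiff _ _ _); apply/funext => q; rewrite metric_grad.
Qed.

End Frames.

(** * The second fundamental form *)

Section CurvatureFields.
Variables (R : realType) (m k : nat) (M : manifold R m) (N : manifold R k).
Variables (psi : M -> N) (g : riemannian N) (nabla : connection N).
Hypothesis lc : is_levi_civita g nabla.
Hypothesis psi_cont : continuous psi.
Hypothesis psi_smooth : forall p, msmooth_at (fun q => chart (psi p) (psi q)) p.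
Implicit Types (p q : M) (W : M -> 'rV[R]_k) (U Y V : M -> 'rV[R]_m).

Local Notation D := (along_nabla nabla psi).
Local Notation asmooth := (along_smooth_at psi).
Let affine := lc_affine lc.

(** Separates the derivative of the components of [Y] from a sum that depends on [Y] only through
    [Y p]. The latter can be compared with extensions of constant components. *)
Lemma along_along p u Y W : vsmooth_at Y p -> asmooth W p ->
  D p u (fun q => D q (Y q) W) =
  D p (mdiff (fun q => coord p q (Y q)) p u) W
  + \sum_b Y p 0 b *: D p u (fun q => D q (ext p (delta_mx 0 b) q) W).
Proof.
move=> sY sW; pose f b q := coord p q (Y q) 0 b.
pose e b : M -> 'rV[R]_m := ext p (delta_mx 0 b).
have sf b : msmooth_at (f b) p by exact: ((msmooth_rVP _ _).1 sY b).
have se b : vsmooth_at (e b) p by exact: vsmooth_ext.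
have sD b : asmooth (fun q => D q (e b q) W) p.
  exact: (along_smooth_nabla affine psi_cont psi_smooth (se b) sW).
have E : {near p, (fun q => \sum_b f b q *: D q (e b q) W) =1 (fun q => D q (Y q) W)}.
  apply: filterS (chart_dom_near (chart_dom_mem p)) => q pq.
  rewrite -[in RHS](coordK (Y q) pq) ext_sum (along_dir_sum psi affine).
  by apply: eq_bigr => b _; rewrite (along_dirZ psi affine).
have sfD b := along_smoothZ (sf b) (sD b).
rewrite (along_eq nabla u E (along_smooth_sum (index_enum _) sfD)).
rewrite (along_sum affine _ u sfD) (row_sum_delta (mdiff _ p u)).
rewrite (along_dir_sum psi affine) -big_split; apply: eq_bigr => b _ /=.
rewrite (alongZ affine u (sf b) (sD b)) (along_dirZ psi affine) (mdiff_rV _ _ sY).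
by rewrite /e ext_id /f coord_id.
Qed.

Lemma along_along_ext p u w W : asmooth W p ->
  D p u (fun q => D q (ext p w q) W) =
  \sum_b w 0 b *: D p u (fun q => D q (ext p (delta_mx 0 b) q) W).
Proof.
move=> sW; rewrite (along_along u (vsmooth_ext p w) sW) ext_id.
have E : {near p, (fun _ => w) =1 (fun q => coord p q (ext p w q))}.
  by apply: filterS (chart_dom_near (chart_dom_mem p)) => q pq; rewrite extE.
by rewrite (mdiff_eq u E (msmooth_cst w p)) mdiff_cst (along_dir0 psi affine) add0r.
Qed.

Lemma along_curvature_fields p U Y W : vsmooth_at U p -> vsmooth_at Y p -> asmooth W p ->
  D p (U p) (fun q => D q (Y q) W) - D p (Y p) (fun q => D q (U q) W)
  - D p (bracket U Y p) W =
  curv_at nabla (psi p) (dmap psi p (U p)) (dmap psi p (Y p)) (W p).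
Proof.
move=> sU sY sW; rewrite -(along_curvature lc psi_cont psi_smooth (U p) (Y p) sW).
rewrite (along_along (U p) sY sW) (along_along (Y p) sU sW).
rewrite -(along_along_ext (U p) (Y p) sW) -(along_along_ext (Y p) (U p) sW).
have DB x y : D p (x - y) W = D p x W - D p y W.
  by rewrite (along_dirD psi affine) -(scaleN1r y) (along_dirZ psi affine) scaleN1r.
rewrite /bracket DB.
set A := D p _ W; set B := D p _ W; set C := D p _ _; set E := D p _ _.
by apply/rowP => b; rewrite !mxE; ring.
Qed.

Lemma along_dmap p u V : vsmooth_at V p ->
  D p u (fun q => dmap psi q (V q)) =
  dmap psi p (mdiff (fun q => coord p q (V q)) p u)
  + \sum_b V p 0 b *: D p u (fun q => dmap psi q (ext p (delta_mx 0 b) q)).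
Proof.
move=> sV; pose f b q := coord p q (V q) 0 b.
pose e b : M -> 'rV[R]_m := ext p (delta_mx 0 b).
have sf b : msmooth_at (f b) p by exact: ((msmooth_rVP _ _).1 sV b).
have sde b : asmooth (fun q => dmap psi q (e b q)) p.
  exact: (along_smooth_dmap psi_cont psi_smooth (vsmooth_ext p _)).
have E : {near p, (fun q => \sum_b f b q *: dmap psi q (e b q)) =1
    (fun q => dmap psi q (V q))}.
  apply: filterS (chart_dom_near (chart_dom_mem p)) => q pq.
  rewrite -[in RHS](coordK (V q) pq) ext_sum dmap_sum.
  by apply: eq_bigr => b _; rewrite dmapZ.
have sfd b := along_smoothZ (sf b) (sde b).
rewrite (along_eq nabla u E (along_smooth_sum (index_enum _) sfd)).
rewrite (along_sum affine _ u sfd) (row_sum_delta (mdiff _ p u)).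
rewrite dmap_sum -big_split; apply: eq_bigr => b _ /=.
rewrite (alongZ affine u (sf b) (sde b)) dmapZ (mdiff_rV _ _ sV).
by rewrite /e ext_id /f coord_id.
Qed.

Lemma along_dmap_ext p u w :
  D p u (fun q => dmap psi q (ext p w q)) =
  \sum_b w 0 b *: D p u (fun q => dmap psi q (ext p (delta_mx 0 b) q)).
Proof.
rewrite (along_dmap u (vsmooth_ext p w)) ext_id.
have E : {near p, (fun _ => w) =1 (fun q => coord p q (ext p w q))}.
  by apply: filterS (chart_dom_near (chart_dom_mem p)) => q pq; rewrite extE.
rewrite (mdiff_eq u E (msmooth_cst w p)) mdiff_cst.
by rewrite dmap0 add0r.
Qed.

End CurvatureFields.

(** * Tangential and normal parts, and the tensor II *)

Section SecondForm.
Variables (R : realType) (m k : nat) (M : manifold R m) (N : manifold R k).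
Variables (g : riemannian M) (gN : riemannian N) (nabla : connection N) (psi : M -> N).
Hypothesis lc : is_levi_civita gN nabla.
Hypothesis psi_cont : continuous psi.
Hypothesis psi_smooth : forall p, msmooth_at (fun q => chart (psi p) (psi q)) p.
Hypothesis psi_isom : forall p u v,
  metric gN (psi p) (dmap psi p u) (dmap psi p v) = metric g p u v.
Implicit Types (p q : M) (w z : 'rV[R]_k) (u v : 'rV[R]_m).
Let affine := lc_affine lc.

Local Notation D := (along_nabla nabla psi).
Local Notation tan := (tan_part g gN psi).
Local Notation nor := (normal_part g gN psi).
Local Notation II := (second_form g gN nabla psi).

Lemma metric_tan_part p w v : metric g p (tan p w) v = metric gN (psi p) w (dmap psi p v).
Proof. by rewrite metric_sharp // => b u' w'; rewrite dmapD dmapZ metricDr metricZr. Qed.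

Lemma metric_normal_part p w v : metric gN (psi p) (nor p w) (dmap psi p v) = 0.
Proof. by rewrite metricBl psi_isom metric_tan_part subrr. Qed.

Lemma tan_partD p w z : tan p (w + z) = tan p w + tan p z.
Proof.
apply/eqP; rewrite -subr_eq0; apply/eqP/(@metric_nondeg _ _ _ g p) => v.
by rewrite metricBl metricDl !metric_tan_part metricDl subrr.
Qed.

Lemma tan_partZ p (a : R) w : tan p (a *: w) = a *: tan p w.
Proof.
apply/eqP; rewrite -subr_eq0; apply/eqP/(@metric_nondeg _ _ _ g p) => v.
by rewrite metricBl metricZl !metric_tan_part metricZl subrr.
Qed.

Lemma tan_part_dmap p u : tan p (dmap psi p u) = u.
Proof.
apply/eqP; rewrite -subr_eq0; apply/eqP/(@metric_nondeg _ _ _ g p) => v.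
by rewrite metricBl metric_tan_part psi_isom subrr.
Qed.

Lemma normal_partD p w z : nor p (w + z) = nor p w + nor p z.
Proof. by rewrite /normal_part tan_partD dmapD opprD addrACA. Qed.

Lemma normal_partZ p (a : R) w : nor p (a *: w) = a *: nor p w.
Proof. by rewrite /normal_part tan_partZ dmapZ scalerBr. Qed.

Lemma normal_part_dmap p u : nor p (dmap psi p u) = 0.
Proof. by rewrite /normal_part tan_part_dmap subrr. Qed.

Lemma normal_part_id p w : (forall v, metric gN (psi p) w (dmap psi p v) = 0) -> nor p w = w.
Proof.
move=> w0; suff t0 : tan p w = 0 by rewrite /normal_part t0 dmap0 subr0.
by apply: (@metric_nondeg _ _ _ g p) => v; rewrite metric_tan_part.
Qed.

Lemma metric_normal_partl p w z : (forall v, metric gN (psi p) z (dmap psi p v) = 0) ->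
  metric gN (psi p) (nor p w) z = metric gN (psi p) w z.
Proof. by move=> z0; rewrite metricBl (metric_sym gN _ (dmap _ _ _)) z0 subr0. Qed.

(** Differentiating the components of [V] contributes a tangential vector only, so every extension
    of [V p] computes the same normal part. *)
Lemma second_formE p u V : vsmooth_at V p ->
  II p u (V p) = nor p (D p u (fun q => dmap psi q (V q))).
Proof.
move=> sV; rewrite (along_dmap lc psi_cont psi_smooth u sV).
by rewrite -(along_dmap_ext lc psi_cont psi_smooth) normal_partD normal_part_dmap add0r.
Qed.

Lemma second_form_sym p u v : II p u v = II p v u.
Proof.
rewrite /second_form /normal_nabla; congr (nor p _).
exact: (along_torsion lc psi_cont psi_smooth).
Qed.

Lemma second_form_linearl p (a : R) u v (w : 'rV[R]_m) :
  II p (a *: u + v) w = a *: II p u w + II p v w.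
Proof.
by rewrite /second_form /normal_nabla (along_dirD psi affine) (along_dirZ psi affine)
  normal_partD normal_partZ.
Qed.

Lemma second_form_linearr p (a : R) u v (w : 'rV[R]_m) :
  II p w (a *: u + v) = a *: II p w u + II p w v.
Proof. by rewrite !(second_form_sym p w) second_form_linearl. Qed.

End SecondForm.

(** * Solitons *)

Lemma sum_mul_delta (R : pzRingType) m (x : 'I_m -> R) i :
  \sum_j x j * (i == j)%:R = x i.
Proof.
rewrite (bigD1 i) //= eqxx mulr1 big1 ?addr0 // => j ji.
by rewrite eq_sym (negbTE ji) mulr0.
Qed.

Section Soliton.
Variables (R : realType) (m n : nat) (M : manifold R m) (N : manifold R n.+1).
Variables (g : riemannian M) (gN : riemannian N).
Variables (nabla : connection M) (nablaN : connection N).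
Variables (psi : M -> N) (X : N -> 'rV[R]_n.+1) (c : R) (phi : N -> R).
Hypothesis lc : is_levi_civita g nabla.
Hypothesis lcN : is_levi_civita gN nablaN.
Hypothesis sX : forall y, vsmooth_at X y.
Hypothesis Xphi : forall y v, nablaN y v X = phi y *: v.
Hypothesis soliton : mcf_soliton g gN nablaN psi X c.
Implicit Types (p q : M) (u v w : 'rV[R]_m) (V : M -> 'rV[R]_m).

Let affineN := lc_affine lcN.
Let psi_cont : continuous psi := imm_cont (proj1 soliton).
Let psi_smooth p : msmooth_at (fun q => chart (psi p) (psi q)) p := imm_smooth (proj1 soliton) p.
Let psi_isom p u v : metric gN (psi p) (dmap psi p u) (dmap psi p v) = metric g p u v
  := imm_isom (proj1 soliton) p u v.

Local Notation D := (along_nabla nablaN psi).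
Local Notation asmooth := (along_smooth_at psi).
Local Notation II := (second_form g gN nablaN psi).
Local Notation nor := (normal_part g gN psi).
Local Notation H := (mean_curvature g gN nablaN psi).
Local Notation T := (fun q => tan_part g gN psi q (X (psi q))).
Local Notation Hsq := (fun q => metric gN (psi q) (H q) (H q)).
Local Notation hH := (second_form_H g gN nablaN psi).

Let HE q : H q = c *: X (psi q) + (- c) *: dmap psi q (T q).
Proof. by rewrite -(proj2 soliton q) /normal_part scalerBr scaleNr. Qed.

(** The factor [c] stays on the left because it may be zero. *)
Let dmap_T q : c *: dmap psi q (T q) = c *: X (psi q) - H q.
Proof. by rewrite HE scaleNr opprD opprK addrA subrr add0r. Qed.

Let H_normal q v : metric gN (psi q) (H q) (dmap psi q v) = 0.
Proof.
by rewrite -(proj2 soliton q) metricZl (metric_normal_part psi_isom) mulr0.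
Qed.

Let sXpsi p : asmooth (fun q => X (psi q)) p.
Proof. by apply: along_smooth_pull => //; exact: sX. Qed.

Let sdmap V p : vsmooth_at V p -> asmooth (fun q => dmap psi q (V q)) p.
Proof. exact: along_smooth_dmap. Qed.

Let sT p : vsmooth_at T p.
Proof.
apply: sharp_smooth => [q b u w|v].
  by rewrite dmapD dmapZ metricDr metricZr.
by apply: msmooth_metric => //; apply: sdmap; exact: vsmooth_ext.
Qed.

(** Smoothness of [H] is read off the soliton equation, from that of [X] and [T]. *)
Let sH p : asmooth H p.
Proof.
have := along_smoothD (along_smoothZ (msmooth_cst c p) (sXpsi p))
  (along_smoothZ (msmooth_cst (- c) p) (sdmap (sT p))).
by apply: along_smooth_eq; apply: nearW => q; rewrite HE.
Qed.

Let sHsq p : msmooth_at Hsq p.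
Proof. exact: msmooth_metric. Qed.

Let DH p u :
  D p u H = (c * phi (psi p)) *: dmap psi p u + (- c) *: D p u (fun q => dmap psi q (T q)).
Proof.
have -> : H = fun q => c *: X (psi q) + (- c) *: dmap psi q (T q).
  by apply/funext => q; exact: HE.
have s1 := msmooth_cst c p; have s2 := msmooth_cst (- c) p.
have sx := sXpsi p; have st := sdmap (sT p).
rewrite (alongD affineN u (along_smoothZ s1 sx) (along_smoothZ s2 st)).
rewrite (alongZ affineN u s1 sx) (alongZ affineN u s2 st) !mdiff_cst !scale0r !add0r.
by rewrite (along_pull affineN psi_cont psi_smooth u (sX (psi p))) Xphi scalerA.
Qed.

(** Weingarten's relation, from differentiating the product of the orthogonal fields [H] and
    dpsi(V). *)
Let shape V p u : vsmooth_at V p ->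
  metric gN (psi p) (D p u (fun q => dmap psi q (V q))) (H p) =
  - metric gN (psi p) (dmap psi p (V p)) (D p u H).
Proof.
move=> sV; have := along_metric lcN psi_cont psi_smooth u (sdmap sV) (sH p).
rewrite (_ : (fun q => _) = fun _ => 0); last first.
  by apply/funext => q; rewrite metric_sym H_normal.
by rewrite mdiff_cst => /esym/eqP; rewrite addr_eq0 => /eqP.
Qed.

Let hHE p u v : hH p u v = - metric gN (psi p) (dmap psi p v) (D p u H).
Proof.
have sv := vsmooth_ext p v.
have := shape u sv; rewrite ext_id => <-.
by rewrite /second_form_H /second_form /normal_nabla (metric_normal_partl _ _ (H_normal p)).
Qed.

Let hH_sym p u v : hH p u v = hH p v u.
Proof. by rewrite /second_form_H (second_form_sym g lcN psi_cont psi_smooth). Qed.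

Let dHsq p u : mdiff Hsq p u = - (2 * c) * hH p u (T p).
Proof.
rewrite (along_metric lcN psi_cont psi_smooth u (sH p) (sH p)).
rewrite (metric_sym gN _ (H p)) -mulr2n -mulr_natl DH metricDl !metricZl.
rewrite (metric_sym gN _ (dmap _ _ _)) H_normal mulr0 add0r.
by rewrite (shape u (sT p)) -hHE; ring.
Qed.

(** * The Laplacian of |H|^2 at a point *)

Section AtPoint.
Variables (p : M) (e : 'I_m -> 'rV[R]_m).
Hypothesis oe : orthonormal_frame g p e.
Variables F F' : 'I_m -> M -> 'rV[R]_m.
Hypothesis FP : forall i, [/\ vsmooth_at (F i) p, F i p = e i &
  forall u, nabla p u (F i) = 0].
Hypothesis F'P : forall i, [/\ vsmooth_at (F' i) p, F' i p = e i &
  forall u, nabla p u (F' i) = 0].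
Hypothesis FF' : \forall q \near p, forall i j, metric g q (F i q) (F' j q) = (i == j)%:R.

Let o := psi p.
Local Notation "<< u , v >>" := (metric gN o u v).
Let sF i : vsmooth_at (F i) p. Proof. by case: (FP i). Qed.
Let Fp i : F i p = e i. Proof. by case: (FP i). Qed.
Let sF' i : vsmooth_at (F' i) p. Proof. by case: (F'P i). Qed.
Let F'p i : F' i p = e i. Proof. by case: (F'P i). Qed.

(** By the Gauss formula the tangential part is the derivative of [F i], which vanishes at [p]; the
    derivative is already normal there. *)
Let DF i u : D p u (fun q => dmap psi q (F i q)) = II p u (e i).
Proof.
rewrite -(Fp i) (second_formE lcN psi_cont psi_smooth psi_isom _ (sF i)).
apply/esym/normal_part_id => v.
rewrite (gauss lc lcN psi_cont psi_smooth psi_isom _ _ (sF i)).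
by case: (FP i) => _ _ ->; rewrite metric0l.
Qed.

(** [B] gives the coefficients of the form [hH] on the frame near [p], [B'] the summands of its
    trace in the dual frames, and [Tc] the coefficients of [T] with respect to [F]. *)
Let B j i q := metric gN (psi q) (D q (F j q) (fun r => dmap psi r (F i r))) (H q).
Let B' i q := metric gN (psi q) (D q (F' i q) (fun r => dmap psi r (F i r))) (H q).
Let Tc j q := metric g q (T q) (F' j q).

Let sDF V i : vsmooth_at V p -> asmooth (fun q => D q (V q) (fun r => dmap psi r (F i r))) p.
Proof.
by move=> sV; apply: (along_smooth_nabla affineN psi_cont psi_smooth sV); exact: sdmap.
Qed.

Let sB j i : msmooth_at (B j i) p.
Proof. by apply: msmooth_metric => //; exact: sDF. Qed.

Let sB' i : msmooth_at (B' i) p.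
Proof. by apply: msmooth_metric => //; exact: sDF. Qed.

Let sTc j : msmooth_at (Tc j) p.
Proof. exact: gram_smooth. Qed.

Let nearF : \forall q \near p, forall i, vsmooth_at (F i) q.
Proof. by apply: filter_forall => i; exact: vsmooth_near. Qed.

(** The dual frames compute the trace [H] at every point near [p], so this sum may be
    differentiated. *)
Let HsqE : {near p, (fun q => \sum_i B' i q) =1 Hsq}.
Proof.
apply: filterS2 FF' nearF => q dual sFq.
have L a u v w : II q (a *: u + v) w = a *: II q u w + II q v w.
  exact: second_form_linearl.
have L' a u v w : II q w (a *: u + v) = a *: II q w u + II q w v.
  exact: second_form_linearr.
have HM : H q = \sum_i II q (F' i q) (F i q) := mtrace_biorthogonal dual L L'.
transitivity (metric gN (psi q) (\sum_i II q (F' i q) (F i q)) (H q)); last by rewrite -HM.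
rewrite metric_suml.
apply: eq_bigr => i _; rewrite -/(hH q (F' i q) (F i q)) hHE.
exact: (shape (F' i q) (sFq i)).
Qed.

Let T_expand : T p = \sum_j Tc j p *: e j.
Proof.
apply: etrans (biorthogonal_expand oe _) _; apply: eq_bigr => j _.
by rewrite /Tc F'p.
Qed.

Let dHsq_near i : {near p, (fun q => \sum_j - (2 * c) * (Tc j q * B j i q)) =1
  (fun q => mdiff Hsq q (F i q))}.
Proof.
apply: filterS2 FF' nearF => q dual sFq.
rewrite dHsq hH_sym -mulr_sumr; congr (_ * _).
rewrite hHE (biorthogonal_expand dual (tan_part g gN psi q (X (psi q)))).
rewrite (along_dir_sum psi affineN).
rewrite metric_sumr -sumrN; apply: eq_bigr => j _.
rewrite (along_dirZ psi affineN) metricZr -mulrN; congr (_ * _).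
exact: (shape (F j q) (sFq i)).
Qed.

Let dTc i j : c * mdiff (Tc j) p (e i) = c * phi o * (i == j)%:R + hH p (e i) (e j).
Proof.
rewrite (lc_metric lc (e i) (sT p) (sF' j)); have [_ _ ->] := F'P j.
rewrite metric0r addr0 F'p.
rewrite -(gauss lc lcN psi_cont psi_smooth psi_isom (e i) (e j) (sT p)).
have E : << D p (e i) H, dmap psi p (e j) >> = c * phi o * (i == j)%:R
    + - c * << D p (e i) (fun q => dmap psi q (T q)), dmap psi p (e j) >>.
  by rewrite DH (metricDl gN o (_ *: _)) !metricZl psi_isom oe.
rewrite hHE (metric_sym gN _ (dmap psi p (e j)) (D p (e i) H)) E; ring.
Qed.

Let brFF i j : bracket (F' i) (F j) p = 0.
Proof.
rewrite -(lc_torsion_free lc (sF' i) (sF j)).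
by have [_ _ ->] := FP j; have [_ _ ->] := F'P i; rewrite subr0.
Qed.

Let dB i j : mdiff (B j i) p (e i) =
  << D p (e j) (fun q => D q (F' i q) (fun r => dmap psi r (F i r))), H p >>
  + << curv_at nablaN o (dmap psi p (e i)) (dmap psi p (e j)) (dmap psi p (e i)), H p >>
  + << II p (e j) (e i), D p (e i) H >>.
Proof.
rewrite (along_metric lcN psi_cont psi_smooth (e i) (sDF i (sF j)) (sH p)).
rewrite -metricDl; congr (<< _, _ >> + << _, _ >>); last by rewrite -DF Fp.
(* The direction [e i] is extended by [F' i], not [F i], so that the exchanged derivative contains
   the summand of [B']. The bracket vanishes because both fields are parallel at [p]. *)
have := along_curvature_fields lcN psi_cont psi_smooth (sF' i) (sF j) (sdmap (sF i)).
rewrite brFF (along_dir0 psi affineN) subr0 F'p !Fp => <-.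
by rewrite addrC subrK.
Qed.

Let dB' i j : << D p (e j) (fun q => D q (F' i q) (fun r => dmap psi r (F i r))), H p >> =
  mdiff (B' i) p (e j) - << II p (e i) (e i), D p (e j) H >>.
Proof.
rewrite (along_metric lcN psi_cont psi_smooth (e j) (sDF i (sF' i)) (sH p)).
by rewrite F'p DF addrK.
Qed.

Let H_frame : H p = \sum_i II p (e i) (e i).
Proof.
apply: (mtrace_biorthogonal oe); first exact: second_form_linearl.
exact: second_form_linearr.
Qed.

(** The sum of the derivatives of [B'] is the derivative of |H|^2, that is 2<D H, H>. The subtracted
    terms add up to <H, D H>, so one half remains. *)
Let sum_dB' j : \sum_i << D p (e j) (fun q => D q (F' i q) (fun r => dmap psi r (F i r))),
  H p >> = 2^-1 * mdiff Hsq p (e j).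
Proof.
rewrite (eq_bigr _ (fun i _ => dB' i j)) sumrB -(mdiff_sum _ _ sB').
have <- := mdiff_eq (e j) HsqE (msmooth_sum _ sB').
rewrite -metric_suml -H_frame.
have E := along_metric lcN psi_cont psi_smooth (e j) (sH p) (sH p).
rewrite (metric_sym gN _ (D p _ _)) in E.
by rewrite E; field.
Qed.

Let norDH i : normal_nabla g gN nablaN psi p (e i) H = - (c *: II p (T p) (e i)).
Proof.
rewrite /normal_nabla DH normal_partD !normal_partZ.
rewrite (normal_part_dmap psi_isom) scaler0 add0r scaleNr.
rewrite -(second_formE lcN psi_cont psi_smooth psi_isom _ (sT p)).
by rewrite (second_form_sym g lcN psi_cont psi_smooth).
Qed.

(** The weighted sum is <II(T, e_i), D H>, and -c II(T, e_i) is itself the normal derivative of [H],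
    so the product becomes a squared norm. *)
Let normal_term i :
  - c * \sum_j Tc j p * << II p (e j) (e i), D p (e i) H >> =
  << normal_nabla g gN nablaN psi p (e i) H, normal_nabla g gN nablaN psi p (e i) H >>.
Proof.
have E : \sum_j Tc j p *: II p (e j) (e i) = II p (T p) (e i).
  rewrite T_expand; elim: (index_enum _) => [|j s IH].
    rewrite !big_nil; have := second_form_linearl g psi lcN p (-1) 0 0 (e i).
    by rewrite scaler0 addr0 scaleN1r addNr => ->.
  by rewrite !big_cons (second_form_linearl g psi lcN) IH.
have -> : \sum_j Tc j p * << II p (e j) (e i), D p (e i) H >> =
    << II p (T p) (e i), D p (e i) H >>.
  by rewrite -E metric_suml; apply: eq_bigr => j _; rewrite metricZl.
rewrite mulNr -metricZl -metricNl -norDH.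
rewrite (metric_sym gN o _ (D p (e i) H)); apply/esym/metric_normal_partl => v.
exact: metric_normal_part psi_isom p _ v.
Qed.

(** The weights assemble dpsi(T), and the factor [c] allows it to be replaced by c X - H. The [X]
    part yields the differential of [phi], because [H] is orthogonal to the unit vector [u]; the [H]
    part yields the remaining curvature term. *)
Let curvature_term i :
  - c * \sum_j Tc j p *
    << curv_at nablaN o (dmap psi p (e i)) (dmap psi p (e j)) (dmap psi p (e i)), H p >> =
  - c * mdiff phi o (H p)
  - << curv_at nablaN o (dmap psi p (e i)) (H p) (H p), dmap psi p (e i) >>.
Proof.
pose u := dmap psi p (e i).
have -> : \sum_j Tc j p * << curv_at nablaN o u (dmap psi p (e j)) u, H p >> =
    - << curv_at nablaN o u (H p) (dmap psi p (T p)), u >>.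
  (* Pair symmetry moves [T] into the third slot, the one in which the curvature of [X] is known. *)
  rewrite -(curv_skew34 lcN) T_expand dmap_sum metric_sumr; apply: eq_bigr => j _.
  by rewrite dmapZ metricZr (curv_pair_sym lcN).
rewrite mulrN mulNr opprK -metricZl.
have c0 : curv_at nablaN o u (H p) 0 = 0.
  by have := curv_at_linear3 lcN o (-1) u (H p) 0 0; rewrite scaler0 addr0 scaleN1r addNr.
have cZ a (w : 'rV[R]_n.+1) : curv_at nablaN o u (H p) (a *: w) =
    a *: curv_at nablaN o u (H p) w.
  by have := curv_at_linear3 lcN o a u (H p) w 0; rewrite !addr0 c0 addr0.
have E : c *: curv_at nablaN o u (H p) (dmap psi p (T p)) =
    c *: (mdiff phi o u *: H p - mdiff phi o (H p) *: u) - curv_at nablaN o u (H p) (H p).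
  rewrite -cZ dmap_T (curv_at_linear3 lcN) (conformal_curvature lcN sX Xphi).
  by rewrite -[- H p]scaleN1r cZ scaleN1r.
rewrite E (metricBl gN o (c *: _)) metricZl (metricBl gN o (_ *: H p)) !metricZl.
have eii : metric g p (e i) (e i) = 1 by rewrite oe eqxx.
rewrite H_normal psi_isom eii -/u; ring.
Qed.

Lemma soliton_identity :
  2^-1 * drift_laplacian g nabla (fun q => - c *: T q) Hsq p =
    - c * phi o * Hsq p
    - (\sum_i \sum_j hH p (e i) (e j) ^+ 2)
    + (\sum_i << normal_nabla g gN nablaN psi p (e i) H,
                 normal_nabla g gN nablaN psi p (e i) H >>)
    - m%:R * c * mdiff phi o (H p)
    - (\sum_i << curv_at nablaN o (dmap psi p (e i)) (H p) (H p), dmap psi p (e i) >>).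
Proof.
have BE j i : B j i p = hH p (e i) (e j).
  by rewrite /B Fp (shape (e j) (sF i)) -hHE Fp hH_sym.
(* The two halves of the product rule for [Tc j * B j i]: [A] differentiates the second fundamental
   form and [A'] the coefficients of [T]. *)
pose A := \sum_i \sum_j Tc j p * mdiff (B j i) p (e i).
pose A' := \sum_i \sum_j B j i p * mdiff (Tc j) p (e i).
have lapE : laplacian nabla g Hsq p = - (2 * c) * (A + A').
  rewrite (laplacian_frame lc oe (sHsq p) FP) -big_split mulr_sumr.
  apply: eq_bigr => i _; rewrite -big_split mulr_sumr.
  have s0 := msmooth_cst (- (2 * c)) p.
  have s1 j := msmoothM (sTc j) (sB j i).
  have s2 j := msmoothM s0 (s1 j).
  rewrite (mdiff_eq (e i) (dHsq_near i) (msmooth_sum _ s2)) (mdiff_sum _ _ s2).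
  apply: eq_bigr => j _; rewrite (mdiffM _ s0 (s1 j)) mdiff_cst mulr0 addr0.
  by rewrite (mdiffM _ (sTc j) (sB j i)).
have trH : Hsq p = \sum_i hH p (e i) (e i).
  have E := congr1 (fun z : 'rV[R]_n.+1 => << z, H p >>) H_frame.
  exact: etrans E (metric_suml _ _ _ _ _).
(* By [dTc] the factor [c] times the derivative of [Tc] is a multiple of the identity plus [hH]. The
   first part gives the trace |H|^2 of [hH], the second its squared norm. *)
have A'E : - c * A' = - c * phi o * Hsq p - \sum_i \sum_j hH p (e i) (e j) ^+ 2.
  rewrite trH !mulr_sumr -sumrB; apply: eq_bigr => i _.
  have -> : - c * phi o * hH p (e i) (e i) =
      \sum_j - c * phi o * (hH p (e i) (e j) * (i == j)%:R).
    by rewrite -mulr_sumr (sum_mul_delta (fun j => hH p (e i) (e j)) i).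
  rewrite mulr_sumr -sumrB; apply: eq_bigr => j _; have := dTc i j; rewrite BE => E.
  transitivity (- (hH p (e i) (e j) * (c * mdiff (Tc j) p (e i)))); first by ring.
  by rewrite E; ring.
have dHsqT : mdiff Hsq p (T p) = \sum_j Tc j p * mdiff Hsq p (e j).
  rewrite T_expand; elim: (index_enum _) => [|j s IH].
    by rewrite !big_nil -(scale0r 0) mdiffZv scale0r.
  by rewrite !big_cons mdiffDv mdiffZv IH.
(* The three terms of [dB], weighted by the coefficients of [T], give in this order half the
   derivative of |H|^2 along [T], the normal derivative and the curvature, up to the exchange of the
   last two. *)
have AE : - c * A = - (c / 2) * mdiff Hsq p (T p)
   + (\sum_i << normal_nabla g gN nablaN psi p (e i) H,
                 normal_nabla g gN nablaN psi p (e i) H >>)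
   + \sum_i (- c * mdiff phi o (H p)
    - << curv_at nablaN o (dmap psi p (e i)) (H p) (H p), dmap psi p (e i) >>).
  have -> : - (c / 2) * mdiff Hsq p (T p) = \sum_i - c * \sum_j Tc j p *
     << D p (e j) (fun q => D q (F' i q) (fun r => dmap psi r (F i r))), H p >>.
    rewrite -mulr_sumr exchange_big /= mulNr -mulrA -mulNr; congr (_ * _).
    rewrite dHsqT mulr_sumr; apply: eq_bigr => j _.
    by rewrite -mulr_sumr sum_dB' mulrCA.
  rewrite -(eq_bigr _ (fun i _ => normal_term i)) -(eq_bigr _ (fun i _ => curvature_term i)).
  rewrite mulr_sumr -!big_split; apply: eq_bigr => i _ /=.
  rewrite -!mulrDr; congr (_ * _); rewrite -!big_split; apply: eq_bigr => j _ /=.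
  by rewrite dB !mulrDr addrAC.
rewrite /drift_laplacian lapE metricZl (metric_sym g p _ (grad _ _ _)) metric_grad.
transitivity (- c * A + - c * A' + c / 2 * mdiff Hsq p (T p)); first by field.
(* The term in the differential of [phi] is the same for every [i]; summing it over the frame
   produces the factor [m]. *)
rewrite AE A'E sumrB sumr_const card_ord -[_ *+ m]mulr_natl.
by field.
Qed.

End AtPoint.
End Soliton.

Unset Implicit Arguments.

Theorem proposition8p1 (R : realType) (m n : nat)
    (M : manifold R m) (N : manifold R n.+1)
    (g : riemannian M) (gN : riemannian N)
    (nabla : connection M) (nablaN : connection N)
    (psi : M -> N) (X : N -> 'rV[R]_n.+1) (c : R)
    (lc_M : is_levi_civita g nabla) (lc_N : is_levi_civita gN nablaN)
    (X_conf : closed_conformal nablaN X)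
    (soliton : mcf_soliton g gN nablaN psi X c)
    (p : M) (e : 'I_m -> 'rV[R]_m) (frame_e : orthonormal_frame g p e) :
  let H := mean_curvature g gN nablaN psi in
  let T := fun q => tan_part g gN psi q (X (psi q)) in
  let phiN := conformal_factor nablaN X in
  let normH2 := fun q => metric gN (psi q) (H q) (H q) in
  2^-1 * drift_laplacian g nabla (fun q => - c *: T q) normH2 p =
    - c * phiN (psi p) * normH2 p
    - (\sum_i \sum_j second_form_H g gN nablaN psi p (e i) (e j) ^+ 2)
    + (\sum_i metric gN (psi p) (normal_nabla g gN nablaN psi p (e i) H)
                                (normal_nabla g gN nablaN psi p (e i) H))
    - m%:R * c * metric gN (psi p) (grad gN phiN (psi p)) (H p)
    - (\sum_i metric gN (psi p)
                (curv_at nablaN (psi p) (dmap psi p (e i)) (H p) (H p))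
                (dmap psi p (e i))).
Proof.
have [sX [f Xf]] := X_conf.
have [F [F' [FP F'P dual]]] := reciprocal_frame lc_M frame_e.
(* Identifies the factor defined by the divergence with the function from closed conformality, whose
   derivative the curvature formula involves. *)
have phiE : conformal_factor nablaN X = f.
  by apply/funext => y; exact: conformal_factorE.
move=> H T phiN normH2; rewrite /phiN phiE metric_grad.
exact: (soliton_identity lc_M lc_N sX Xf soliton frame_e FP F'P dual).
Qed.
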